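(* Let $T(t,\tau)$ be an evolution family on a Banach space $X$ admitting a strong nonuniform polynomial dichotomy with constant $\epsilon\ge0$, and let $B:[1,\infty)\to B(X)$ be strongly continuous with $\|B(t)\|\le c/t^{1+\epsilon}$ for all $t\ge1$, for some $c>0$. Let $U(t,\tau)$ be the evolution family satisfying $$U(t,\tau)=T(t,\tau)+\int_\tau^tT(t,s)B(s)U(s,\tau)\,ds,\quad t\ge\tau\ge1.$$ Then, provided $c>0$ is sufficiently small, $U(t,\tau)$ admits a strong nonuniform polynomial dichotomy.
   Context: Let $X$ be a Banach space with norm $\|\cdot\|$ and $B(X)$ the space of bounded linear operators on $X$. An evolution family is a family of bounded linear operators $T(t,\tau)$ on $X$, $t\ge\tau\ge1$, such that $T(t,t)=\mathrm{Id}$ for $t\ge1$, $T(t,s)T(s,\tau)=T(t,\tau)$ for $t\ge s\ge\tau\ge1$, and for each $\tau\ge1$ and $x\in X$ the map $s\mapsto T(s,\tau)x$ is continuous on $[\tau,\infty)$. $T(t,\tau)$ admits a nonuniform polynomial dichotomy if there are projections $P(t)$, $t\ge1$, with $P(t)T(t,\tau)=T(t,\tau)P(\tau)$ for $t\ge\tau\ge1$ and $T(t,\tau)|_{\ker P(\tau)}:\ker P(\tau)\to\ker P(t)$ invertible for $t\ge\tau\ge1$, and constants $\lambda,D>0$, $\epsilon\ge0$ such that for $t,\tau\ge1$: $\|T(t,\tau)P(\tau)\|\le D(t/\tau)^{-\lambda}\tau^\epsilon$ for $t\ge\tau$ and $\|T(t,\tau)Q(\tau)\|\le D(\tau/t)^{-\lambda}\tau^\epsilon$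 for $t\le\tau$, where $Q(t)=\mathrm{Id}-P(t)$ and for $t<\tau$, $T(t,\tau)=(T(\tau,t)|_{\ker P(t)})^{-1}:\ker P(\tau)\to\ker P(t)$. It admits a strong nonuniform polynomial dichotomy if in addition there are $K,b>0$ with $\|T(t,\tau)\|\le K(t/\tau)^b\tau^\epsilon$ for all $t\ge\tau\ge1$. *)

(* Defs.v *)
From Stdlib Require Import Reals Lra.
Open Scope R_scope.
Set Implicit Arguments.

Record Banach := {
  car :> Type;
  vzero : car;
  vadd : car -> car -> car;
  vopp : car -> car;
  vscal : R -> car -> car;
  vnorm : car -> R;
  vadd_assoc : forall x y z, vadd x (vadd y z) = vadd (vadd x y) z;
  vadd_comm : forall x y, vadd x y = vadd y x;
  vadd_0 : forall x, vadd x vzero = x;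
  vadd_opp : forall x, vadd x (vopp x) = vzero;
  vscal_assoc : forall a b x, vscal a (vscal b x) = vscal (a * b) x;
  vscal_1 : forall x, vscal 1 x = x;
  vscal_distr_l : forall a x y, vscal a (vadd x y) = vadd (vscal a x) (vscal a y);
  vscal_distr_r : forall a b x, vscal (a + b) x = vadd (vscal a x) (vscal b x);
  vnorm_nonneg : forall x, 0 <= vnorm x;
  vnorm_eq0 : forall x, vnorm x = 0 -> x = vzero;
  vnorm_zero : vnorm vzero = 0;
  vnorm_triangle : forall x y, vnorm (vadd x y) <= vnorm x + vnorm y;
  vnorm_scal : forall a x, vnorm (vscal a x) = Rabs a * vnorm x;
  vcomplete : forall u : nat -> car,
    (forall e, 0 < e -> exists N, forall m n, (N <= m)%nat -> (N <= n)%nat ->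
        vnorm (vadd (u m) (vopp (u n))) < e) ->
    exists l, forall e, 0 < e -> exists N, forall n, (N <= n)%nat ->
        vnorm (vadd (u n) (vopp l)) < e
}.

Arguments vzero {b0} : rename.

Definition vsub {X : Banach} (x y : X) : X := vadd X x (vopp X y).

Definition bounded_linear {X : Banach} (L : X -> X) : Prop :=
  (forall x y, L (vadd X x y) = vadd X (L x) (L y)) /\
  (forall a x, L (vscal X a x) = vscal X a (L x)) /\
  (exists M, forall x, vnorm X (L x) <= M * vnorm X x).

Fixpoint rsum {X : Banach} (f : R -> X) (p xi : nat -> R) (n : nat) : X :=
  match n with
  | O => vzero
  | S k => vadd X (rsum f p xi k) (vscal X (p (S k) - p k) (f (xi k)))
  end.

Definition is_RInt {X : Banach} (f : R -> X) (a b : R) (I : X) : Prop :=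
  forall e, 0 < e -> exists delta, 0 < delta /\
    forall (n : nat) (p xi : nat -> R),
      p O = a -> p n = b ->
      (forall k, (k < n)%nat -> p k <= xi k <= p (S k) /\ p (S k) - p k < delta) ->
      vnorm X (vsub (rsum f p xi n) I) < e.

Definition continuous_from {X : Banach} (g : R -> X) (a : R) : Prop :=
  forall s0, a <= s0 -> forall e, 0 < e -> exists delta, 0 < delta /\
    forall s, a <= s -> Rabs (s - s0) < delta -> vnorm X (vsub (g s) (g s0)) < e.

Definition evolution_family {X : Banach} (T : R -> R -> X -> X) : Prop :=
  (forall t tau, 1 <= tau -> tau <= t -> bounded_linear (T t tau)) /\
  (forall t x, 1 <= t -> T t t x = x) /\
  (forall t s tau x, 1 <= tau -> tau <= s -> s <= t -> T t s (T s tau x) = T t tau x) /\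
  (forall tau x, 1 <= tau -> continuous_from (fun s => T s tau x) tau).

(** Nonuniform polynomial dichotomy with constant eps.  The operator-norm bound
    ||A|| <= M is written as forall x, ||A x|| <= M ||x||.  For t <= tau,
    T(t,tau)Q(tau)x is the unique y in ker P(t) with T(tau,t) y = Q(tau) x. *)
Definition npd {X : Banach} (T : R -> R -> X -> X) (eps : R) : Prop :=
  exists (P : R -> X -> X) (lam D : R), 0 < lam /\ 0 < D /\
    (forall t, 1 <= t -> bounded_linear (P t) /\ forall x, P t (P t x) = P t x) /\
    (forall t tau x, 1 <= tau -> tau <= t -> P t (T t tau x) = T t tau (P tau x)) /\
    (forall t tau, 1 <= tau -> tau <= t ->
       (forall x1 x2, P tau x1 = vzero -> P tau x2 = vzero ->
          T t tau x1 = T t tau x2 -> x1 = x2) /\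
       (forall y, P t y = vzero -> exists x, P tau x = vzero /\ T t tau x = y)) /\
    (forall t tau x, 1 <= tau -> tau <= t ->
       vnorm X (T t tau (P tau x))
         <= D * Rpower (t / tau) (- lam) * Rpower tau eps * vnorm X x) /\
    (forall t tau x y, 1 <= t -> t <= tau ->
       P t y = vzero -> T tau t y = vsub x (P tau x) ->
       vnorm X y <= D * Rpower (tau / t) (- lam) * Rpower tau eps * vnorm X x).

Definition strong_npd {X : Banach} (T : R -> R -> X -> X) (eps : R) : Prop :=
  npd T eps /\
  exists K b, 0 < K /\ 0 < b /\
    forall t tau x, 1 <= tau -> tau <= t ->
      vnorm X (T t tau x) <= K * Rpower (t / tau) b * Rpower tau eps * vnorm X x.

(* Main.v *)
Require Import Defs.
From Stdlib Require Import Reals Lra Lia ClassicalEpsilon.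
Open Scope R_scope.

(** Measure vectors at time [t] with the adapted norm
    [N t x], the supremum of [(s/t)^lam |T(s,t)P(t)x|] and [(s/t)^(-b) |T(s,t)x|] over
    [s >= t] and of [(t/s)^lam |T(s,t)Q(t)x|] over [s <= t].  It satisfies
    [|x| <= N t x <= C t^eps |x|], makes the dichotomy of [T] uniform with constant [1],
    and turns the hypothesis on [B] into [N t (B(t)x) <= (C c / t) N t x].  The factor
    [t^eps] lost in the norm is exactly the one gained from [B]; the growth term must
    involve [T] and not [TQ], which would cost [t^(2 eps)].

    Hence over one step [tau <= t <= h tau], with [h^lam = 16], [U] is a perturbation of
    [T] as small as we please, and the rest is a cone argument on the grids [h^n tau].
    The unstable spaces are [F(t) = U(t,1) ker P(1)]; they stay graphs over [ker P(t)].
    The stable spaces [E(t)] consist of the vectors with bounded forward orbit.  A vector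
    [x] is split by taking [y_n] in [F(tau)] such that [U(h^n tau, tau)(x - y_n)] has no
    unstable component: the cone estimates make [y_n] a Cauchy sequence, and its limit
    [f] satisfies [x - f] in [E(tau)].  The projection onto [E(t)] along [F(t)] is the
    one sought, with the same [eps]. *)

(** * Vectors and seminorms *)

Notation "x +v y" := (vadd _ x y) (at level 50, left associativity).
Notation "x -v y" := (vsub x y) (at level 50, left associativity).
Notation "-v x" := (vopp _ x) (at level 35, right associativity).

Section VectorAlgebra.
Variable X : Banach.
Implicit Types x y z : X.

Lemma vadd_0l x : vzero +v x = x.
Proof. now rewrite vadd_comm, vadd_0. Qed.

Lemma vadd_swap x y z : x +v (y +v z) = y +v (x +v z).
Proof. now rewrite !vadd_assoc, (vadd_comm _ x y). Qed.

Lemma vadd_opp_cancel x y : x +v (-v x +v y) = y.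
Proof. now rewrite vadd_assoc, vadd_opp, vadd_0l. Qed.

Lemma vopp_unique x y : x +v y = vzero -> y = -v x.
Proof.
intro H. rewrite <- (vadd_opp_cancel x y), vadd_swap, H. apply vadd_0.
Qed.

Lemma vopp_opp x : -v -v x = x.
Proof. symmetry; apply vopp_unique. now rewrite vadd_comm, vadd_opp. Qed.

Lemma vopp_add x y : -v (x +v y) = -v x +v -v y.
Proof.
symmetry; apply vopp_unique.
now rewrite <- vadd_assoc, (vadd_swap y), vadd_opp, vadd_0, vadd_opp.
Qed.

Lemma vopp_zero : -v (@vzero X) = vzero.
Proof. symmetry; apply vopp_unique, vadd_0. Qed.

Lemma vsub_eq0 x y : x -v y = vzero -> x = y.
Proof.
unfold vsub; intro H. apply vopp_unique in H.
now rewrite <- (vopp_opp x), <- (vopp_opp y), H, vopp_opp.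
Qed.

Lemma vscal_0 x : vscal X 0 x = vzero.
Proof. apply vnorm_eq0. rewrite vnorm_scal, Rabs_R0; ring. Qed.

Lemma vopp_scal x : -v x = vscal X (-1) x.
Proof.
symmetry; apply vopp_unique. rewrite <- (vscal_1 _ x) at 1.
rewrite <- vscal_distr_r. replace (1 + -1) with 0 by ring. apply vscal_0.
Qed.
End VectorAlgebra.

Ltac vremove x l :=
  match l with
  | vadd _ x ?r => r
  | vadd ?X ?y ?r => let s := vremove x r in constr:(vadd X y s)
  end.

(** Bubbles the opposite summand [y] to the head of the tail, so that the pair has the shape
    required by [vadd_opp_cancel]. *)
Ltac vcancel x y :=
  match goal with
  | |- vadd ?X x ?l = vzero =>
      let s := vremove y l in
      replace l with (vadd X y s) by
        (repeat first [reflexivity | rewrite (vadd_swap _ y); f_equal])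
  end.

(* Decides identities of abelian groups by cancelling opposite summands. *)
Ltac vabel :=
  apply vsub_eq0; unfold vsub;
  rewrite ?vopp_add, ?vopp_opp, ?vopp_zero;
  match goal with |- ?l = _ => rewrite <- (vadd_0 _ l) end;
  rewrite <- ?vadd_assoc; rewrite ?vadd_0l;
  repeat match goal with
  | |- vadd ?X (vopp _ ?x) ?l = vzero =>
      vcancel (vopp X x) x; rewrite <- (vopp_opp _ x) at 2;
      rewrite vadd_opp_cancel
  | |- vadd ?X ?x ?l = vzero =>
      vcancel x (vopp X x); rewrite vadd_opp_cancel
  end; reflexivity.

Section Linear.
Context {X : Banach} {L : X -> X}.
Hypothesis HL : bounded_linear L.

Lemma lin_add x y : L (x +v y) = L x +v L y.
Proof. apply HL. Qed.

Lemma lin_scal a x : L (vscal X a x) = vscal X a (L x).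
Proof. apply HL. Qed.

Lemma lin_opp x : L (-v x) = -v (L x).
Proof. now rewrite !vopp_scal, lin_scal. Qed.

Lemma lin_sub x y : L (x -v y) = L x -v L y.
Proof. unfold vsub. now rewrite lin_add, lin_opp. Qed.

Lemma lin_0 : L vzero = vzero.
Proof. now rewrite <- (vscal_0 _ vzero), lin_scal, !vscal_0. Qed.
End Linear.

Lemma vscal_sub (X : Banach) a (x y : X) :
  vscal X a (x -v y) = vscal X a x -v vscal X a y.
Proof.
unfold vsub. rewrite vscal_distr_l, !vopp_scal, !vscal_assoc.
now rewrite (Rmult_comm a).
Qed.

Lemma bounded_linear_compl {X : Banach} {L : X -> X} :
  bounded_linear L -> bounded_linear (fun x => x -v L x).
Proof.
intros HL. split; [|split].
- intros x y. rewrite (lin_add HL). vabel.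
- intros a x. now rewrite (lin_scal HL), vscal_sub.
- destruct HL as [_ [_ [M HM]]]. exists (1 + M). intro x.
  unfold vsub. eapply Rle_trans; [apply vnorm_triangle|].
  rewrite vopp_scal, vnorm_scal, Rabs_left by lra.
  specialize (HM x). lra.
Qed.

(** Homogeneity is an inequality, the form in which a least upper bound yields it. The last clause
    is continuity, which carries estimates over to limits of Riemann sums and of sequences. *)
Definition cseminorm {X : Banach} (N : X -> R) : Prop :=
  (forall x y, N (x +v y) <= N x + N y) /\
  (forall a x, N (vscal X a x) <= Rabs a * N x) /\
  (exists C, 0 <= C /\ forall x, N x <= C * vnorm X x).

Section Seminorm.
Context {X : Banach} {N : X -> R}.
Hypothesis HN : cseminorm N.

Lemma sn_add x y : N (x +v y) <= N x + N y.
Proof. apply HN. Qed.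

Lemma sn_scal a x : N (vscal X a x) <= Rabs a * N x.
Proof. apply HN. Qed.

Lemma sn_opp x : N (-v x) <= N x.
Proof.
rewrite vopp_scal. generalize (sn_scal (-1) x).
rewrite Rabs_left by lra. lra.
Qed.

Lemma sn_sub x y : N (x -v y) <= N x + N y.
Proof.
unfold vsub. generalize (sn_add x (-v y)) (sn_opp y). lra.
Qed.

Lemma sn_0 : N vzero = 0.
Proof.
destruct HN as [_ [_ [C [_ HC]]]].
generalize (HC vzero) (sn_add vzero vzero). rewrite vnorm_zero, vadd_0. lra.
Qed.

Lemma sn_ge0 x : 0 <= N x.
Proof. generalize (sn_add x (-v x)) (sn_opp x). rewrite vadd_opp, sn_0. lra. Qed.

Lemma sn_sub_rev x y : N x - N y <= N (x -v y).
Proof.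
generalize (sn_add (x -v y) y). replace (x -v y +v y) with x by vabel. lra.
Qed.

Lemma sn_sym x y : N (x -v y) <= N (y -v x).
Proof. replace (x -v y) with (-v (y -v x)) by vabel. apply sn_opp. Qed.

Lemma sn_comp {L} : bounded_linear L -> cseminorm (fun x => N (L x)).
Proof.
intro HL. split; [|split].
- intros x y. rewrite (lin_add HL). apply sn_add.
- intros a x. rewrite (lin_scal HL). apply sn_scal.
- destruct HN as [_ [_ [C [HC0 HC]]]]. destruct HL as [_ [_ [M HM]]].
  exists (C * Rmax M 0). split.
  + apply Rmult_le_pos; [easy | apply Rmax_r].
  + intro x. eapply Rle_trans; [apply HC|]. rewrite Rmult_assoc.
    apply Rmult_le_compat_l; [easy|]. eapply Rle_trans; [apply HM|].
    apply Rmult_le_compat_r; [apply vnorm_nonneg | apply Rmax_l].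
Qed.

Lemma sn_rsum (f : R -> X) (p xi : nat -> R) (M : R) n :
  (forall k, (k < n)%nat -> p k <= p (S k) /\ N (f (xi k)) <= M) ->
  N (rsum f p xi n) <= M * (p n - p O).
Proof.
induction n as [|n IH]; intro H; simpl.
- rewrite sn_0. lra.
- eapply Rle_trans; [apply sn_add|].
  assert (N (rsum f p xi n) <= M * (p n - p O)) by (apply IH; intros; apply H; lia).
  destruct (H n ltac:(lia)) as [H1 H2].
  generalize (sn_scal (p (S n) - p n) (f (xi n))).
  rewrite Rabs_pos_eq by lra. intro H3.
  assert ((p (S n) - p n) * N (f (xi n)) <= (p (S n) - p n) * M)
    by (apply Rmult_le_compat_l; lra).
  lra.
Qed.

(** Riemann sums over uniform partitions, tagged at left endpoints, already satisfy the bound;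
    continuity of [N] carries it to the integral. *)
Lemma sn_RInt_le (f : R -> X) a b I M :
  a <= b -> is_RInt f a b I -> (forall s, a <= s <= b -> N (f s) <= M) ->
  N I <= M * (b - a).
Proof.
intros Hab HI HM.
destruct HN as [_ [_ [C [HC0 HC]]]].
apply le_epsilon. intros e He.
(* The tolerance is chosen so that [C] times it is at most [e]; the [+ 1] covers [C = 0]. *)
destruct (HI (e / (C + 1))) as [d [Hd HR]]; [apply Rdiv_lt_0_compat; lra|].
destruct (INR_unbounded ((b - a) / d)) as [m Hm].
assert (Hm0 : 0 <= (b - a) / d)
  by (apply Rmult_le_pos; [lra | apply Rlt_le, Rinv_0_lt_compat; lra]).
set (w := (b - a) / INR m).
assert (Hw : 0 <= w)
  by (apply Rmult_le_pos; [lra | apply Rlt_le, Rinv_0_lt_compat; lra]).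
assert (Hwd : w < d).
{ unfold w. apply Rmult_lt_reg_r with (INR m); [lra|].
  unfold Rdiv. rewrite Rmult_assoc, Rinv_l, Rmult_1_r by lra.
  apply Rmult_lt_reg_r with (/ d); [apply Rinv_0_lt_compat; lra|].
  replace (d * INR m * / d) with (INR m) by (field; lra). exact Hm. }
assert (Hwm : INR m * w = b - a) by (unfold w; field; lra).
set (p := fun k => a + INR k * w).
assert (Hpp : forall k, p (S k) - p k = w) by (intro k; unfold p; rewrite S_INR; ring).
assert (Hp0 : p O = a) by (unfold p; simpl; ring).
assert (Hpm : p m = b) by (unfold p; lra).
assert (Hint : forall k, (k < m)%nat -> a <= p k <= b).
{ intros k Hk. apply lt_INR in Hk. generalize (pos_INR k). intro.
  assert (INR k * w <= INR m * w) by (apply Rmult_le_compat_r; lra).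
  assert (0 <= INR k * w) by (apply Rmult_le_pos; lra).
  unfold p; lra. }
specialize (HR m p p Hp0 Hpm).
assert (Hsum : N (rsum f p p m) <= M * (p m - p O)).
{ apply sn_rsum. intros k Hk. split; [generalize (Hpp k); lra | now apply HM, Hint]. }
rewrite Hp0, Hpm in Hsum.
assert (Hdist : vnorm X (rsum f p p m -v I) < e / (C + 1)).
{ apply HR. intros k Hk. generalize (Hpp k). lra. }
generalize (sn_sub_rev I (rsum f p p m)) (sn_sym I (rsum f p p m)) (HC (rsum f p p m -v I)).
assert (C * vnorm X (rsum f p p m -v I) <= C * (e / (C + 1)))
  by (apply Rmult_le_compat_l; lra).
assert (C * (e / (C + 1)) <= e).
{ apply Rmult_le_reg_r with (C + 1); [lra|].
  replace (C * (e / (C + 1)) * (C + 1)) with (C * e) by (field; lra). lra. }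
lra.
Qed.
End Seminorm.

Lemma cseminorm_vnorm (X : Banach) : cseminorm (vnorm X).
Proof.
split; [|split].
- apply vnorm_triangle.
- intros a x. rewrite vnorm_scal. lra.
- exists 1. split; [lra|]. intro; lra.
Qed.

(** Stands in for passages to the limit: later estimates hold up to an error of order [2^(-n)],
    which is discarded here. *)
Lemma le0_of_geometric (a M : R) : (forall n : nat, a <= M * (1 / 2) ^ n) -> a <= 0.
Proof.
intro H. destruct (Rle_dec M 0) as [HM|HM].
- specialize (H O). simpl in H. lra.
- apply le_epsilon. intros e He. rewrite Rplus_0_l.
  destruct (pow_lt_1_zero (1 / 2)) with (y := e / M) as [n Hn].
  + rewrite Rabs_pos_eq; lra.
  + apply Rdiv_lt_0_compat; lra.
  + specialize (Hn n (le_n n)). specialize (H n).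
    rewrite Rabs_pos_eq in Hn by (apply pow_le; lra).
    assert (M * (1 / 2) ^ n <= M * (e / M)) by (apply Rmult_le_compat_l; lra).
    replace (M * (e / M)) with e in * by (field; lra). lra.
Qed.

Lemma geometric_limit {X : Banach} (u : nat -> X) (M : R) :
  (forall n, vnorm X (u (S n) -v u n) <= M * (1 / 2) ^ n) ->
  exists l, forall n, vnorm X (l -v u n) <= 2 * M * (1 / 2) ^ n.
Proof.
intro H. pose proof (cseminorm_vnorm X) as HV.
assert (HM : 0 <= M).
{ generalize (H O) (vnorm_nonneg X (u 1%nat -v u O)). simpl. lra. }
(* Keeping the exact telescoped geometric sum, rather than its upper bound, makes the induction on
   [k] close. *)
assert (Hk : forall n k, vnorm X (u (n + k)%nat -v u n)
                         <= 2 * M * ((1 / 2) ^ n - (1 / 2) ^ (n + k))).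
{ intros n k. induction k as [|k IH].
  - rewrite Nat.add_0_r. unfold vsub. rewrite vadd_opp, vnorm_zero. lra.
  - rewrite Nat.add_succ_r.
    replace (u (S (n + k)) -v u n)
      with ((u (S (n + k)) -v u (n + k)%nat) +v (u (n + k)%nat -v u n)) by vabel.
    eapply Rle_trans; [apply vnorm_triangle|]. specialize (H (n + k)%nat).
    simpl pow. lra. }
assert (Hpos : forall n, 0 <= (1 / 2) ^ n) by (intro; apply pow_le; lra).
assert (Hk' : forall n m, (n <= m)%nat -> vnorm X (u m -v u n) <= 2 * M * (1 / 2) ^ n).
{ intros n m Hnm. replace m with (n + (m - n))%nat by lia.
  eapply Rle_trans; [apply Hk|]. apply Rmult_le_compat_l; [lra|].
  generalize (Hpos (n + (m - n))%nat). lra. }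
destruct (vcomplete X u) as [l Hl].
- intros e He.
  destruct (pow_lt_1_zero (1 / 2)) with (y := e / (4 * M + 1)) as [N HN].
  + rewrite Rabs_pos_eq; lra.
  + apply Rdiv_lt_0_compat; lra.
  + exists N. intros m n Hm Hn. specialize (HN N (le_n N)).
    rewrite Rabs_pos_eq in HN by apply Hpos.
    change (vnorm X (u m -v u n) < e).
    replace (u m -v u n) with ((u m -v u N) -v (u n -v u N)) by vabel.
    eapply Rle_lt_trans; [apply (sn_sub HV)|].
    generalize (Hk' N m Hm) (Hk' N n Hn). intros.
    assert ((4 * M + 1) * (1 / 2) ^ N < e).
    { apply Rmult_lt_compat_l with (r := 4 * M + 1) in HN; [|lra].
      replace ((4 * M + 1) * (e / (4 * M + 1))) with e in HN by (field; lra). exact HN. }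
    generalize (Hpos N). lra.
- exists l. intro n. apply le_epsilon. intros e He.
  destruct (Hl e He) as [N HN]. specialize (HN (N + n)%nat ltac:(lia)).
  replace (l -v u n) with ((u (N + n)%nat -v u n) -v (u (N + n)%nat -v l)) by vabel.
  eapply Rle_trans; [apply (sn_sub HV)|].
  generalize (Hk' n (N + n)%nat ltac:(lia)). unfold vsub in *. lra.
Qed.

(** * Real powers *)

(** Translates rates per grid step into power rates. The exponent [ln g / ln h] is the one for which
    [h] to that power is [g], so on the [n]-th grid interval the power of [t / tau] lies within a
    factor [g] of [g ^ n]. *)
Lemma scale_cover (h g tau t : R) :
  1 < h -> 1 < g -> 0 < tau -> tau <= t ->
  exists n : nat, h ^ n * tau <= t <= h * (h ^ n * tau) /\
    g ^ n <= Rpower (t / tau) (ln g / ln h) <= g * g ^ n.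
Proof.
intros Hh Hg Htau Ht.
assert (Hcov : exists n, h ^ n * tau <= t <= h * (h ^ n * tau)).
{ destruct (Pow_x_infinity h) with (b := t / tau) as [m Hm].
  { rewrite Rabs_pos_eq; lra. }
  specialize (Hm m (le_n m)).
  rewrite Rabs_pos_eq in Hm by (apply pow_le; lra).
  apply Rge_le, Rmult_le_compat_r with (r := tau) in Hm; [|lra].
  replace (t / tau * tau) with t in Hm by (field; lra).
  (* The exponent is lowered until [h ^ m * tau] first falls below [t]. *)
  induction m as [|m IH].
  - exists O. simpl in *. assert (tau <= h * tau) by (rewrite <- Rmult_1_l at 1;
      apply Rmult_le_compat_r; lra). lra.
  - destruct (Rle_dec t (h ^ m * tau)) as [H|H]; [now apply IH|].
    exists m. simpl in Hm. lra. }
destruct Hcov as [n Hn]. exists n. split; [exact Hn|].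
assert (Hlnh : 0 < ln h) by (rewrite <- ln_1; apply ln_increasing; lra).
assert (Hlng : 0 < ln g) by (rewrite <- ln_1; apply ln_increasing; lra).
assert (Hpow : forall k : nat, Rpower (h ^ k) (ln g / ln h) = g ^ k).
{ intro k. rewrite <- (Rpower_pow k h), <- (Rpower_pow k g) by lra.
  rewrite Rpower_mult. unfold Rpower. f_equal. field. lra. }
assert (Hk : 0 <= ln g / ln h) by (apply Rlt_le, Rdiv_lt_0_compat; lra).
change (g * g ^ n) with (g ^ S n).
assert (Hpos : 0 < h ^ n) by (apply pow_lt; lra).
rewrite <- !Hpow. split; apply Rle_Rpower_l; try easy; split.
- exact Hpos.
- apply Rmult_le_reg_r with tau; [lra|].
  replace (t / tau * tau) with t by (field; lra). lra.
- apply Rdiv_lt_0_compat; lra.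
- apply Rmult_le_reg_r with tau; [lra|].
  replace (t / tau * tau) with t by (field; lra). simpl. lra.
Qed.

Lemma Rpower_pos a b : 0 < Rpower a b.
Proof. apply exp_pos. Qed.

Lemma Rpower_ge1 a b : 1 <= a -> 0 <= b -> 1 <= Rpower a b.
Proof.
intros Ha Hb. rewrite <- (Rpower_O a) by lra. now apply Rle_Rpower.
Qed.

Lemma Rpower_neg_le1 a b : 1 <= a -> 0 <= b -> Rpower a (- b) <= 1.
Proof.
intros Ha Hb. rewrite <- (Rpower_O a) by lra. apply Rle_Rpower; lra.
Qed.

Lemma Rpower_opp_l a b : Rpower a (- b) * Rpower a b = 1.
Proof. rewrite <- Rpower_plus, Rplus_opp_l. unfold Rpower. rewrite Rmult_0_l. apply exp_0. Qed.

Lemma ratio_ge1 t tau : 0 < tau -> tau <= t -> 1 <= t / tau.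
Proof.
intros Htau Ht. apply Rmult_le_reg_r with tau; [easy|].
unfold Rdiv. rewrite Rmult_assoc, Rinv_l by lra. lra.
Qed.

Lemma Rpower_ratio s t tau a : 0 < s -> 0 < t -> 0 < tau ->
  Rpower (s / t) a * Rpower (t / tau) a = Rpower (s / tau) a.
Proof.
intros Hs Ht Htau. rewrite Rpower_mult_distr by (apply Rdiv_lt_0_compat; lra).
f_equal. field. lra.
Qed.

Lemma Rpower_move r a v n : Rpower r a * v <= n <-> v <= Rpower r (- a) * n.
Proof.
generalize (Rpower_opp_l r a) (Rpower_pos r a) (Rpower_pos r (- a)). intros E H1 H2.
split; intro H.
- apply Rmult_le_compat_l with (r := Rpower r (- a)) in H; [|lra].
  rewrite <- Rmult_assoc, E in H. lra.
- apply Rmult_le_compat_l with (r := Rpower r a) in H; [|lra].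
  rewrite <- Rmult_assoc, (Rmult_comm (Rpower r a) (Rpower r (- a))), E in H. lra.
Qed.

(** * Cones and the splitting *)

Section Cones.
Context {X : Banach} {U : R -> R -> X -> X} {P : R -> X -> X} {N : R -> X -> R}.
Context {h G : R}.

(** Both components refer to the projections of the unperturbed family, so they are only
    approximately preserved by [U]. *)
Definition snorm t x := N t (P t x).
Definition unorm t x := N t (x -v P t x).

Hypothesis h_gt1 : 1 < h.
Hypothesis G_gt1 : 1 < G.
Hypothesis HU : evolution_family U.
Hypothesis HP : forall t, 1 <= t ->
  bounded_linear (P t) /\ forall x, P t (P t x) = P t x.
Hypothesis HN : forall t, 1 <= t -> cseminorm (N t).
Hypothesis vnorm_le_N : forall t x, 1 <= t -> vnorm X x <= N t x.
Hypothesis N_P : forall t x, 1 <= t -> N t (P t x) <= N t x.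
Hypothesis N_U : forall t tau x, 1 <= tau -> tau <= t <= h * tau ->
  N t (U t tau x) <= G * N tau x.
(** In these four estimates the terms [(snorm + unorm) / 16] account for the difference between [U]
    and [T]. What remains is the action of [T]: no loss over a partial step, a factor [1 / 16] or
    [16] over a full one. *)
Hypothesis snorm_U : forall t tau x, 1 <= tau -> tau <= t <= h * tau ->
  snorm t (U t tau x) <= snorm tau x + (snorm tau x + unorm tau x) / 16.
Hypothesis unorm_U : forall t tau x, 1 <= tau -> tau <= t <= h * tau ->
  unorm tau x - (snorm tau x + unorm tau x) / 16 <= unorm t (U t tau x).
Hypothesis snorm_U_step : forall tau x, 1 <= tau ->
  snorm (h * tau) (U (h * tau) tau x) <= snorm tau x / 16 + (snorm tau x + unorm tau x) / 16.
Hypothesis unorm_U_step : forall tau x, 1 <= tau ->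
  16 * unorm tau x - (snorm tau x + unorm tau x) / 16 <= unorm (h * tau) (U (h * tau) tau x).
(** The intended [y] is the exact preimage of [z] under [T]. The error is measured on any [x] whose
    unstable part is [y], since the vectors later used are points of a graph over [ker P(tau)]. *)
Hypothesis approx_onto : forall t tau z, 1 <= tau -> tau <= t <= h * tau ->
  P t z = vzero ->
  exists y, P tau y = vzero /\ N tau y <= N t z /\
    forall x, x -v P tau x = y ->
      N t ((U t tau x -v P t (U t tau x)) -v z) <= (snorm tau x + unorm tau x) / 16.

Lemma U_lin t tau : 1 <= tau -> tau <= t -> bounded_linear (U t tau).
Proof. apply HU. Qed.

Lemma U_id t x : 1 <= t -> U t t x = x.
Proof. apply HU. Qed.

Lemma U_comp t s tau x : 1 <= tau -> tau <= s -> s <= t ->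
  U t s (U s tau x) = U t tau x.
Proof. apply HU. Qed.

Lemma snorm_sn t : 1 <= t -> cseminorm (snorm t).
Proof. intro Ht. apply (sn_comp (HN t Ht)), HP, Ht. Qed.

Lemma unorm_sn t : 1 <= t -> cseminorm (unorm t).
Proof. intro Ht. apply (sn_comp (HN t Ht)), bounded_linear_compl, HP, Ht. Qed.

Lemma N_le_snorm_unorm t x : 1 <= t -> N t x <= snorm t x + unorm t x.
Proof.
intro Ht. unfold snorm, unorm. replace x with (P t x +v (x -v P t x)) at 1 by vabel.
now apply sn_add, HN.
Qed.

Lemma snorm_unorm_le_N t x : 1 <= t -> snorm t x + unorm t x <= 3 * N t x.
Proof.
intro Ht. unfold snorm, unorm. generalize (N_P t x Ht) (sn_sub (HN t Ht) x (P t x)). lra.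
Qed.

Lemma eq0_of_snorm_unorm t x : 1 <= t -> snorm t x + unorm t x <= 0 -> x = vzero.
Proof.
intros Ht H. apply vnorm_eq0.
generalize (vnorm_le_N t x Ht) (N_le_snorm_unorm t x Ht) (vnorm_nonneg X x). lra.
Qed.

Lemma kernel_compl t x : 1 <= t -> P t (x -v P t x) = vzero.
Proof.
intro Ht. destruct (HP t Ht) as [HL Hid]. rewrite (lin_sub HL), Hid.
apply vadd_opp.
Qed.

Lemma compl_sub t x y : 1 <= t ->
  (x -v y) -v P t (x -v y) = (x -v P t x) -v (y -v P t y).
Proof. intro Ht. rewrite (lin_sub (proj1 (HP t Ht))). vabel. Qed.

Lemma snorm_kernel t x : 1 <= t -> P t x = vzero -> snorm t x = 0.
Proof. intros Ht H. unfold snorm. rewrite H. apply (sn_0 (HN t Ht)). Qed.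

Lemma grid_ge tau n : 1 <= tau -> 1 <= tau <= h ^ n * tau.
Proof.
intro Ht. split; [easy|]. rewrite <- (Rmult_1_l tau) at 1.
apply Rmult_le_compat_r; [lra|]. apply pow_R1_Rle. lra.
Qed.

Lemma step_ge tau : 1 <= tau -> 1 <= tau <= h * tau.
Proof. intro Ht. generalize (grid_ge tau 1 Ht). now rewrite pow_1. Qed.

Lemma U_grid_first n tau x : 1 <= tau ->
  U (h ^ n * (h * tau)) (h * tau) (U (h * tau) tau x) = U (h ^ S n * tau) tau x.
Proof.
intro Ht. pose proof (step_ge tau Ht) as Hs.
assert (Hs1 : 1 <= h * tau) by lra. pose proof (grid_ge (h * tau) n Hs1) as Hg.
rewrite U_comp by lra. f_equal. simpl. ring.
Qed.

Lemma U_grid_last n tau x : 1 <= tau ->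
  U (h * (h ^ n * tau)) (h ^ n * tau) (U (h ^ n * tau) tau x) = U (h ^ S n * tau) tau x.
Proof.
intro Ht. pose proof (grid_ge tau n Ht) as Hg.
assert (Hg1 : 1 <= h ^ n * tau) by lra. pose proof (step_ge _ Hg1) as Hs.
rewrite U_comp by lra. f_equal. simpl. ring.
Qed.

(** * Invariance of the unstable and stable cones *)

(** In the cone the coupling error is at most an eighth of the unstable part, small against the
    expansion by 16. The image therefore enters the narrower cone of slope [1 / 2]. *)
Lemma cone_step tau x : 1 <= tau -> snorm tau x <= unorm tau x ->
  2 * snorm (h * tau) (U (h * tau) tau x) <= unorm (h * tau) (U (h * tau) tau x) /\
  4 * unorm tau x <= unorm (h * tau) (U (h * tau) tau x).
Proof.
intros Ht H. generalize (snorm_U_step tau x Ht) (unorm_U_step tau x Ht)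
  (sn_ge0 (snorm_sn tau Ht) x). lra.
Qed.

Lemma cone_expand n tau x : 1 <= tau -> snorm tau x <= unorm tau x ->
  snorm (h ^ n * tau) (U (h ^ n * tau) tau x) <= unorm (h ^ n * tau) (U (h ^ n * tau) tau x) /\
  4 ^ n * unorm tau x <= unorm (h ^ n * tau) (U (h ^ n * tau) tau x).
Proof.
intros Ht H. induction n as [|n IH].
- rewrite pow_O, Rmult_1_l, U_id by easy. simpl. lra.
- pose proof (grid_ge tau n Ht) as Hg.
  destruct (cone_step (h ^ n * tau) (U (h ^ n * tau) tau x)) as [H1 H2]; [lra|apply IH|].
  rewrite U_grid_last in H1, H2 by easy.
  replace (h * (h ^ n * tau)) with (h ^ S n * tau) in H1, H2 by (simpl; ring).
  assert (Hg' : 1 <= h ^ S n * tau) by (generalize (grid_ge tau (S n) Ht); lra).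
  generalize (sn_ge0 (snorm_sn _ Hg') (U (h ^ S n * tau) tau x)).
  split; [lra|]. replace (4 ^ S n) with (4 * 4 ^ n) by (simpl; ring). lra.
Qed.

(** The first conclusion is the contrapositive of [cone_step]: a vector strictly inside the unstable
    cone cannot land in the stable one. The contraction then follows, the error being at most an
    eighth of the stable part. *)
Lemma cone_step_back tau x : 1 <= tau ->
  unorm (h * tau) (U (h * tau) tau x) <= snorm (h * tau) (U (h * tau) tau x) ->
  unorm tau x <= snorm tau x /\ 4 * snorm (h * tau) (U (h * tau) tau x) <= snorm tau x.
Proof.
intros Ht H. generalize (snorm_U_step tau x Ht). intro Hal.
assert (Hs : 1 <= h * tau) by (generalize (step_ge tau Ht); lra).
assert (unorm tau x <= snorm tau x).
{ destruct (Rle_dec (unorm tau x) (snorm tau x)) as [Hle|Hle]; [easy|].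
  destruct (cone_step tau x Ht) as [H1 H2]; [lra|].
  generalize (sn_ge0 (snorm_sn tau Ht) x) (sn_ge0 (snorm_sn _ Hs) (U (h * tau) tau x)). lra. }
generalize (sn_ge0 (snorm_sn tau Ht) x). lra.
Qed.

(** The cone condition travels backwards from the end of the orbit, so the induction peels off the
    first step, not the last. *)
Lemma cone_contract n tau x : 1 <= tau ->
  unorm (h ^ n * tau) (U (h ^ n * tau) tau x) <= snorm (h ^ n * tau) (U (h ^ n * tau) tau x) ->
  unorm tau x <= snorm tau x /\ 4 ^ n * snorm (h ^ n * tau) (U (h ^ n * tau) tau x) <= snorm tau x.
Proof.
revert tau x. induction n as [|n IH]; intros tau x Ht H.
- simpl pow in *. rewrite !Rmult_1_l in *. rewrite U_id in * by easy. lra.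
- assert (Hs : 1 <= h * tau) by (generalize (step_ge tau Ht); lra).
  destruct (IH (h * tau) (U (h * tau) tau x) Hs) as [H1 H2].
  + rewrite U_grid_first by easy.
    replace (h ^ n * (h * tau)) with (h ^ S n * tau) by (simpl; ring). exact H.
  + destruct (cone_step_back tau x Ht H1) as [H3 H4]. split; [easy|].
    rewrite U_grid_first in H2 by easy.
    replace (h ^ n * (h * tau)) with (h ^ S n * tau) in H2 by (simpl; ring).
    replace (4 ^ S n) with (4 * 4 ^ n) by (simpl; ring). lra.
Qed.

(** * Graphs over the kernels of the projections *)

(** [F] is the graph of a map from [ker P(t)] to the range of [P(t)] with slope at most [1 / 2].
    Closure under differences and the cone condition make the point over each [y] unique. *)
Definition unstable_graph (t : R) (F : X -> Prop) : Prop :=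
  (forall x y, F x -> F y -> F (x -v y)) /\
  (forall x, F x -> 2 * snorm t x <= unorm t x) /\
  (forall y, P t y = vzero -> exists f, F f /\ f -v P t f = y).

Lemma graph_snorm_le t F x : 1 <= t -> unstable_graph t F -> F x -> snorm t x <= unorm t x.
Proof.
intros Ht HF Hx. generalize (proj1 (proj2 HF) x Hx) (sn_ge0 (snorm_sn t Ht) x). lra.
Qed.

(** The limit is taken in [ker P(t)], where the unstable parts converge, and then lifted to [F]. The
    cone condition turns convergence of unstable parts into convergence in [N t]. *)
Lemma graph_complete t F (u : nat -> X) M : 1 <= t -> unstable_graph t F ->
  (forall n, F (u n)) ->
  (forall n, unorm t (u (S n) -v u n) <= M * (1 / 2) ^ n) ->
  exists f C, F f /\ forall n, N t (f -v u n) <= C * (1 / 2) ^ n.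
Proof.
intros Ht HF Hu HM.
destruct (geometric_limit (fun n => u n -v P t (u n)) M) as [y Hy].
{ intro n. rewrite <- compl_sub by easy. eapply Rle_trans; [|apply HM].
  now apply vnorm_le_N. }
assert (Py : P t y = vzero).
{ destruct (sn_comp (cseminorm_vnorm X) (proj1 (HP t Ht))) as [_ [_ [C [HC0 HC]]]].
  apply vnorm_eq0, Rle_antisym; [|apply vnorm_nonneg].
  apply le0_of_geometric with (C * (2 * M)). intro n. rewrite Rmult_assoc.
  eapply Rle_trans; [|apply Rmult_le_compat_l; [exact HC0|apply (Hy n)]].
  eapply Rle_trans; [|apply HC].
  rewrite (lin_sub (proj1 (HP t Ht))), kernel_compl by easy.
  right; f_equal; vabel. }
destruct (proj2 (proj2 HF) y Py) as [f [Ff Hf]].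
destruct (HN t Ht) as [_ [_ [C [HC0 HC]]]].
exists f, (2 * (C * (2 * M))). split; [easy|]. intro n.
assert (Hbe : unorm t (f -v u n) <= C * (2 * M) * (1 / 2) ^ n).
{ unfold unorm. rewrite compl_sub, Hf by easy. eapply Rle_trans; [apply HC|].
  rewrite Rmult_assoc. apply Rmult_le_compat_l; [easy|apply Hy]. }
assert (Fd : F (f -v u n)) by (apply (proj1 HF); easy).
generalize (graph_snorm_le t F _ Ht HF Fd) (N_le_snorm_unorm t (f -v u n) Ht). lra.
Qed.

(* Neumann series: [approx_onto] solves [Q U f = z] up to half of [z], and the errors
   are solved for in turn. *)
Lemma graph_image t tau F : 1 <= tau -> tau <= t <= h * tau -> unstable_graph tau F ->
  forall z, P t z = vzero -> exists f, F f /\ U t tau f -v P t (U t tau f) = z.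
Proof.
intros Htau Ht HF z Pz.
assert (Ht1 : 1 <= t) by lra.
pose proof (HN t Ht1) as HNt.
pose proof (U_lin t tau Htau (proj1 Ht)) as HUl.
set (V := fun f => U t tau f -v P t (U t tau f)).
assert (V_sub : forall x y, V (x -v y) = V x -v V y).
{ intros x y. unfold V. now rewrite (lin_sub HUl), compl_sub. }
assert (PV : forall x, P t (V x) = vzero) by (intro x; now apply kernel_compl).
(* The condition on [w] stands under the existential so that choice gives a total function; vectors
   outside the kernel receive [vzero]. *)
assert (Hg : forall w, exists f, P t w = vzero ->
  F f /\ unorm tau f <= N t w /\ N t (w -v V f) <= 1 / 2 * N t w).
{ intro w. destruct (classic (P t w = vzero)) as [Pw|]; [|now exists vzero].
  destruct (approx_onto t tau w Htau Ht Pw) as [y [Py [Hy HA]]].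
  destruct (proj2 (proj2 HF) y Py) as [f [Ff Hf]].
  exists f. intros _. assert (Hbe : unorm tau f = N tau y) by (unfold unorm; now rewrite Hf).
  split; [easy|]. split; [lra|].
  generalize (HA f Hf) (sn_sym HNt w (V f)) (graph_snorm_le tau F f Htau HF Ff)
    (sn_ge0 HNt w). unfold V. lra. }
pose (g := fun w => proj1_sig (constructive_indefinite_description _ (Hg w))).
assert (g_spec : forall w, P t w = vzero ->
  F (g w) /\ unorm tau (g w) <= N t w /\ N t (w -v V (g w)) <= 1 / 2 * N t w).
{ intro w. exact (proj2_sig (constructive_indefinite_description _ (Hg w))). }
clearbody g.
(* [w n] is the residual and [u n] the sum of the first [n] corrections, so that
   [V (u n) = z - w n]. *)
pose (w := fix w n := match n with O => z | S k => w k -v V (g (w k)) end).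
pose (u := fix u n := match n with O => vzero | S k => u k +v g (w k) end).
assert (Pw : forall n, P t (w n) = vzero).
{ induction n as [|n IH]; [easy|]. simpl.
  rewrite (lin_sub (proj1 (HP t Ht1))), PV, IH. vabel. }
assert (Nw : forall n, N t (w n) <= N t z * (1 / 2) ^ n).
{ induction n as [|n IH]; [simpl; lra|].
  destruct (g_spec (w n) (Pw n)) as [_ [_ H]]. simpl. simpl in H. lra. }
assert (F0 : F vzero).
{ destruct (g_spec z Pz) as [Fz _]. generalize (proj1 HF _ _ Fz Fz).
  now replace (g z -v g z) with (@vzero X) by vabel. }
assert (Fu : forall n, F (u n)).
{ induction n as [|n IH]; [easy|]. simpl.
  (* A sum is written as a double difference, because [F] is given as closed under differences. *)
  replace (u n +v g (w n)) with (u n -v (vzero -v g (w n))) by vabel.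
  apply (proj1 HF); [easy|]. apply (proj1 HF); [easy|]. now apply g_spec. }
assert (Vu : forall n, V (u n) = z -v w n).
{ induction n as [|n IH].
  - simpl. replace (@vzero X) with (z -v z) by vabel. rewrite V_sub. vabel.
  - simpl. replace (u n +v g (w n)) with (u n -v ((u n -v u n) -v g (w n))) by vabel.
    rewrite !V_sub, IH. vabel. }
destruct (graph_complete tau F u (N t z) Htau HF Fu) as [f [C [Ff Hf]]].
{ intro n. simpl. replace (u n +v g (w n) -v u n) with (g (w n)) by vabel.
  destruct (g_spec (w n) (Pw n)) as [_ [H _]]. specialize (Nw n). lra. }
exists f. split; [easy|]. change (V f = z).
apply vsub_eq0, vnorm_eq0, Rle_antisym; [|apply vnorm_nonneg].
apply le0_of_geometric with (3 * (G * C) + N t z). intro n.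
replace (V f -v z) with (V (f -v u n) -v w n) by (rewrite V_sub, Vu; vabel).
eapply Rle_trans; [apply (vnorm_le_N t); easy|].
eapply Rle_trans; [apply (sn_sub HNt)|].
generalize (snorm_unorm_le_N t (U t tau (f -v u n)) Ht1) (N_U t tau (f -v u n) Htau Ht)
  (sn_ge0 (snorm_sn t Ht1) (U t tau (f -v u n))) (Nw n).
assert (G * N tau (f -v u n) <= G * (C * (1 / 2) ^ n))
  by (apply Rmult_le_compat_l; [lra|apply Hf]).
unfold V. unfold unorm. lra.
Qed.

(** * The unstable spaces *)

Definition unstable t x := exists y, P 1 y = vzero /\ x = U t 1 y.

Lemma unstable_sub t x y : 1 <= t -> unstable t x -> unstable t y -> unstable t (x -v y).
Proof.
intros Ht [x' [Px ->]] [y' [Py ->]]. exists (x' -v y'). split.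
- rewrite (lin_sub (proj1 (HP 1 (Rle_refl 1)))), Px, Py. vabel.
- now rewrite (lin_sub (U_lin t 1 (Rle_refl 1) Ht)).
Qed.

Lemma unstable_U t tau x : 1 <= tau -> tau <= t -> unstable tau x -> unstable t (U t tau x).
Proof. intros Htau Ht [y [Py ->]]. exists y. split; [easy|]. apply U_comp; lra. Qed.

Lemma unstable_lift t tau x : 1 <= tau -> tau <= t -> unstable t x ->
  exists y, unstable tau y /\ U t tau y = x.
Proof.
intros Htau Ht [y [Py ->]]. exists (U tau 1 y). split; [now exists y|]. apply U_comp; lra.
Qed.

Lemma unstable_graph_start : unstable_graph 1 (unstable 1).
Proof.
split; [|split].
- intros x y. apply unstable_sub. lra.
- intros x [y [Py ->]]. rewrite U_id by lra. rewrite snorm_kernel by (easy || lra).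
  generalize (sn_ge0 (unorm_sn 1 (Rle_refl 1)) y). lra.
- intros y Py. exists y. split.
  + exists y. split; [easy|]. rewrite U_id; [easy|lra].
  + rewrite Py. vabel.
Qed.

(** Induction on the number of factors [h] needed to reach [t]. Up to time [h] one starts from
    [ker P(1)], where the stable part vanishes, and a single partial step keeps the slope below
    [1 / 2]. Surjectivity comes from [graph_image] in both cases. *)
Lemma unstable_is_graph t : 1 <= t -> unstable_graph t (unstable t).
Proof.
assert (Hpow : forall n t, 1 <= t <= h * h ^ n -> unstable_graph t (unstable t)).
{ clear t. induction n as [|n IH]; intros t Ht.
  - simpl in Ht. split; [|split].
    + intros x y. apply unstable_sub. lra.
    + intros x [y [Py ->]].
      generalize (snorm_U t 1 y ltac:(lra) ltac:(lra)) (unorm_U t 1 y ltac:(lra) ltac:(lra))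
        (sn_ge0 (unorm_sn 1 (Rle_refl 1)) y).
      rewrite (snorm_kernel 1 y) by (easy || lra). lra.
    + intros y Py.
      destruct (graph_image t 1 (unstable 1)) with (z := y) as [f [Ff Hf]];
        [lra | lra | apply unstable_graph_start | easy |].
      exists (U t 1 f). split; [|easy]. apply unstable_U; [lra|lra|easy].
  - destruct (Rle_dec t (h * h ^ n)) as [Hle|Hgt]; [apply IH; lra|].
    (* Going back by exactly one full step matters: only the full step restores the slope [1 / 2],
       while partial steps could let it deteriorate. *)
    set (tau := t / h). assert (E : t = h * tau) by (unfold tau; field; lra).
    assert (Hn : 1 <= h ^ n) by (apply pow_R1_Rle; lra).
    assert (Htau : 1 <= tau <= h * h ^ n).
    { split; apply Rmult_le_reg_l with h; try lra; rewrite <- E; [|apply Ht].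
      assert (h * 1 <= h * h ^ n) by (apply Rmult_le_compat_l; lra). lra. }
    specialize (IH tau Htau). pose proof (step_ge tau (proj1 Htau)) as Hs.
    rewrite E. split; [|split].
    + intros x y. apply unstable_sub. lra.
    + intros x Hx. destruct (unstable_lift (h * tau) tau x) as [y [Fy <-]];
        [lra | lra | easy |].
      apply cone_step; [lra|]. apply graph_snorm_le with (unstable tau); easy || lra.
    + intros y Py.
      destruct (graph_image (h * tau) tau (unstable tau)) with (z := y) as [f [Ff Hf]];
        [lra | lra | easy | easy |].
      exists (U (h * tau) tau f). split; [|easy]. apply unstable_U; [lra|lra|easy]. }
intro Ht. destruct (scale_cover h h 1 t) as [n [Hn _]]; try lra.
apply (Hpow n). lra.
Qed.

Lemma unstable_cone t x : 1 <= t -> unstable t x -> 2 * snorm t x <= unorm t x.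
Proof. intros Ht. apply (unstable_is_graph t Ht). Qed.

(** * The stable spaces *)

Definition stable tau x := exists M, forall s, tau <= s -> N s (U s tau x) <= M.

Lemma stable_U t tau x : 1 <= tau -> tau <= t -> stable tau x -> stable t (U t tau x).
Proof.
intros Htau Ht [M HM]. exists M. intros s Hs. rewrite U_comp by lra. apply HM. lra.
Qed.

Lemma stable_sub tau x y : 1 <= tau -> stable tau x -> stable tau y -> stable tau (x -v y).
Proof.
intros Htau [M HM] [M' HM']. exists (M + M'). intros s Hs.
rewrite (lin_sub (U_lin s tau Htau Hs)).
assert (Hs1 : 1 <= s) by lra.
generalize (sn_sub (HN s Hs1) (U s tau x) (U s tau y)) (HM s Hs) (HM' s Hs). lra.
Qed.

(** Outside the stable cone the orbit lies in the unstable one, where [cone_expand] makes it grow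
    like [4 ^ n]. *)
Lemma stable_cone tau x : 1 <= tau -> stable tau x -> unorm tau x <= snorm tau x.
Proof.
intros Htau [M HM]. destruct (Rle_dec (unorm tau x) (snorm tau x)) as [|Hgt]; [easy|].
exfalso. generalize (sn_ge0 (snorm_sn tau Htau) x). intro Hal.
(* A bound [M] on [N] bounds the unstable part by [3 * M], so [n] is chosen to push that part to
   [3 * M + 1]. *)
destruct (Pow_x_infinity 4) with (b := (3 * M + 1) / unorm tau x) as [n Hn].
{ rewrite Rabs_pos_eq; lra. }
specialize (Hn n (le_n n)). rewrite Rabs_pos_eq in Hn by (apply pow_le; lra).
pose proof (grid_ge tau n Htau) as Hg.
destruct (cone_expand n tau x Htau) as [_ H]; [lra|].
apply Rge_le, Rmult_le_compat_r with (r := unorm tau x) in Hn; [|lra].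
replace ((3 * M + 1) / unorm tau x * unorm tau x) with (3 * M + 1) in Hn by (field; lra).
assert (Hg1 : 1 <= h ^ n * tau) by lra.
generalize (HM (h ^ n * tau) (proj2 Hg)) (snorm_unorm_le_N _ (U (h ^ n * tau) tau x) Hg1)
  (sn_ge0 (snorm_sn _ Hg1) (U (h ^ n * tau) tau x)). lra.
Qed.

(** The cone condition at the last grid time controls all earlier ones through [cone_contract]. The
    factor 2 bounds [N] by the stable part in the cone, and [G] pays for the final partial step. *)
Lemma stable_decay n t tau x : 1 <= tau ->
  unorm (h ^ n * tau) (U (h ^ n * tau) tau x) <= snorm (h ^ n * tau) (U (h ^ n * tau) tau x) ->
  h ^ n * tau <= t <= h * (h ^ n * tau) ->
  4 ^ n * N t (U t tau x) <= 2 * G * snorm tau x.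
Proof.
intros Htau H Ht. pose proof (grid_ge tau n Htau) as Hg.
assert (Hg1 : 1 <= h ^ n * tau) by lra.
destruct (cone_contract n tau x Htau H) as [_ H1].
rewrite <- (U_comp t (h ^ n * tau) tau) by lra.
set (y := U (h ^ n * tau) tau x) in *.
assert (H2 : N t (U t (h ^ n * tau) y) <= G * (2 * snorm (h ^ n * tau) y)).
{ eapply Rle_trans; [apply N_U; easy|]. apply Rmult_le_compat_l; [lra|].
  generalize (N_le_snorm_unorm _ y Hg1). lra. }
apply Rmult_le_compat_l with (r := 4 ^ n) in H2; [|apply pow_le; lra].
apply Rmult_le_compat_l with (r := 2 * G) in H1; [|lra]. lra.
Qed.

Lemma stable_of_cone tau x : 1 <= tau ->
  (forall n, unorm (h ^ n * tau) (U (h ^ n * tau) tau x)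
             <= snorm (h ^ n * tau) (U (h ^ n * tau) tau x)) ->
  stable tau x.
Proof.
intros Htau H. exists (2 * G * snorm tau x). intros s Hs.
destruct (scale_cover h h tau s) as [n [Hn _]]; try lra.
eapply Rle_trans; [|apply (stable_decay n s tau x Htau (H n) Hn)].
assert (Hs1 : 1 <= s) by lra.
rewrite <- (Rmult_1_l (N s _)) at 1. apply Rmult_le_compat_r; [now apply sn_ge0, HN|].
apply pow_R1_Rle. lra.
Qed.

(** * Splitting into stable and unstable vectors *)

(** Transversality of the cones: [unorm f] is at most [unorm x + snorm x + snorm f], and the last
    term is absorbed since it is at most half of [unorm f]. This is what bounds the new
    projections. *)
Lemma split_bound tau x f : 1 <= tau -> unstable tau f ->
  unorm tau (x -v f) <= snorm tau (x -v f) ->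
  unorm tau f <= 2 * (snorm tau x + unorm tau x) /\
  snorm tau (x -v f) <= 2 * (snorm tau x + unorm tau x).
Proof.
intros Htau Hf H. generalize (unstable_cone tau f Htau Hf) (sn_sub (snorm_sn tau Htau) x f)
  (sn_sub_rev (unorm_sn tau Htau) f x) (sn_sym (unorm_sn tau Htau) f x)
  (sn_ge0 (unorm_sn tau Htau) x). lra.
Qed.

Lemma splitting tau x : 1 <= tau -> exists f, unstable tau f /\ stable tau (x -v f).
Proof.
intro Htau.
set (t := fun n => h ^ n * tau).
assert (t_ge : forall n, 1 <= tau <= t n) by (intro n; now apply grid_ge).
assert (t_ge1 : forall n, 1 <= t n) by (intro n; generalize (t_ge n); lra).
assert (Ut_lin : forall n, bounded_linear (U (t n) tau))
  by (intro n; apply U_lin; [easy | apply t_ge]).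
assert (Hy : forall n, exists f, unstable tau f /\ unorm (t n) (U (t n) tau (x -v f)) = 0).
{ intro n.
  destruct (unstable_is_graph (t n) (t_ge1 n)) as [_ [_ Honto]].
  destruct (Honto (U (t n) tau x -v P (t n) (U (t n) tau x))) as [f' [Ff' Hf']].
  { now apply kernel_compl. }
  destruct (unstable_lift (t n) tau f') as [f [Ff Hf]];
    [easy | apply t_ge | easy |].
  exists f. split; [easy|]. unfold unorm.
  rewrite (lin_sub (Ut_lin n)), compl_sub, Hf, Hf' by easy.
  unfold vsub at 1. rewrite vadd_opp. now apply sn_0, HN. }
pose (y := fun n => proj1_sig (constructive_indefinite_description _ (Hy n))).
assert (y_spec : forall n, unstable tau (y n) /\ unorm (t n) (U (t n) tau (x -v y n)) = 0).
{ intro n. exact (proj2_sig (constructive_indefinite_description _ (Hy n))). }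
clearbody y.
(* At time [t (k + n)] the orbit of [x - y (k + n)] has no unstable part, hence it lies in the
   stable cone at the earlier grid time [t n]. *)
assert (Hcone : forall k n,
  unorm (t n) (U (t n) tau (x -v y (k + n)%nat)) <= snorm (t n) (U (t n) tau (x -v y (k + n)%nat))).
{ intros k n. set (v := U (t n) tau (x -v y (k + n)%nat)).
  apply (cone_contract k (t n) v (t_ge1 n)). unfold v, t.
  pose proof (t_ge n) as H1. pose proof (grid_ge (t n) k (t_ge1 n)) as H2.
  unfold t in H1, H2.
  rewrite U_comp by lra. rewrite <- Rmult_assoc, <- pow_add.
  fold (t (k + n)%nat). rewrite (proj2 (y_spec (k + n)%nat)).
  now apply sn_ge0, snorm_sn. }
set (M := 2 * (snorm tau x + unorm tau x)).
assert (Hw : forall n, snorm tau (x -v y n) <= M).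
{ intro n. apply split_bound; [easy | apply y_spec |].
  generalize (Hcone n O). unfold t. rewrite pow_O, Rmult_1_l, Nat.add_0_r.
  now rewrite U_id. }
assert (HM : 0 <= M).
{ generalize (sn_ge0 (snorm_sn tau Htau) x) (sn_ge0 (unorm_sn tau Htau) x). unfold M. lra. }
(* The difference [d] is unstable, so its unstable part has grown by [4 ^ n] at time [t n]. There it
   is at most the unstable part of the orbit of [x - y (S n)], since that of [x - y n] vanishes, and
   the cone condition with [cone_contract] bounds this by [M]. *)
assert (Hd : forall n, unorm tau (y (S n) -v y n) <= M * (1 / 2) ^ n).
{ intro n. set (d := y (S n) -v y n).
  assert (Fd : unstable tau d) by (apply unstable_sub; [easy | apply y_spec | apply y_spec]).
  destruct (cone_expand n tau d Htau) as [_ H1].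
  { generalize (unstable_cone tau d Htau Fd) (sn_ge0 (snorm_sn tau Htau) d). lra. }
  fold (t n) in H1.
  assert (H2 : unorm (t n) (U (t n) tau d) <= unorm (t n) (U (t n) tau (x -v y (S n)))).
  { replace d with ((x -v y n) -v (x -v y (S n))) by (unfold d; vabel).
    rewrite (lin_sub (Ut_lin n)). eapply Rle_trans; [apply (sn_sub (unorm_sn _ (t_ge1 n)))|].
    rewrite (proj2 (y_spec n)). lra. }
  destruct (cone_contract n tau (x -v y (S n)) Htau (Hcone 1%nat n)) as [_ H3].
  fold (t n) in H3. generalize (Hcone 1%nat n) (Hw (S n)). simpl Nat.add. intros H4 H5.
  assert (H6 : 1 <= 4 ^ n) by (apply pow_R1_Rle; lra).
  assert (H7 : 4 ^ n * (1 / 2) ^ n = 2 ^ n)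
    by (rewrite <- Rpow_mult_distr; f_equal; lra).
  assert (H8 : 1 <= 2 ^ n) by (apply pow_R1_Rle; lra).
  apply Rmult_le_reg_l with (4 ^ n); [lra|].
  replace (4 ^ n * (M * (1 / 2) ^ n)) with (M * 2 ^ n) by (rewrite <- H7; ring).
  assert (M * 1 <= M * 2 ^ n) by (apply Rmult_le_compat_l; lra).
  assert (0 <= snorm (t n) (U (t n) tau (x -v y (S n)))) by (apply sn_ge0, snorm_sn; easy).
  assert (1 * snorm (t n) (U (t n) tau (x -v y (S n)))
          <= 4 ^ n * snorm (t n) (U (t n) tau (x -v y (S n))))
    by (apply Rmult_le_compat_r; lra).
  lra. }
destruct (graph_complete tau (unstable tau) y M Htau (unstable_is_graph tau Htau))
  as [f [C [Ff Hf]]]; [intro n; apply y_spec | exact Hd |].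
exists f. split; [easy|]. apply stable_of_cone; [easy|]. intro n. fold (t n).
pose proof (sn_comp (snorm_sn _ (t_ge1 n)) (Ut_lin n)) as Sa.
pose proof (sn_comp (unorm_sn _ (t_ge1 n)) (Ut_lin n)) as Sb.
destruct (Sa) as [_ [_ [Ca [Ca0 HCa]]]]. destruct (Sb) as [_ [_ [Cb [Cb0 HCb]]]].
apply Rminus_le.
(* For fixed [n] the cone condition is closed: it holds for [x - y (m + n)] and passes to [x - f],
   with an error geometric in [m]. *)
apply le0_of_geometric with ((Ca + Cb) * (C * (1 / 2) ^ n)). intro m.
set (w := x -v y (m + n)%nat).
assert (Hdist : vnorm X (f -v y (m + n)%nat) <= C * (1 / 2) ^ n * (1 / 2) ^ m).
{ rewrite Rmult_assoc, <- pow_add, (Nat.add_comm n m).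
  eapply Rle_trans; [now apply (vnorm_le_N tau)|apply Hf]. }
generalize (sn_sub_rev Sa w (x -v f)) (sn_sub_rev Sb (x -v f) w)
  (sn_sym Sb (x -v f) w) (Hcone m n).
fold w. replace (w -v (x -v f)) with (f -v y (m + n)%nat) by (unfold w; vabel).
generalize (HCa (f -v y (m + n)%nat)) (HCb (f -v y (m + n)%nat)).
assert ((Ca + Cb) * vnorm X (f -v y (m + n)%nat)
        <= (Ca + Cb) * (C * (1 / 2) ^ n * (1 / 2) ^ m))
  by (apply Rmult_le_compat_l; lra).
lra.
Qed.

Lemma stable_unstable_eq0 tau x : 1 <= tau -> stable tau x -> unstable tau x -> x = vzero.
Proof.
intros Htau Hs Hu. apply (eq0_of_snorm_unorm tau); [easy|].
generalize (stable_cone tau x Htau Hs) (unstable_cone tau x Htau Hu)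
  (sn_ge0 (snorm_sn tau Htau) x). lra.
Qed.

(** Source of the algebra of the new projection: its linearity, idempotence and commutation with [U]
    are each obtained by exhibiting a decomposition. *)
Lemma split_unique tau x e1 e2 : 1 <= tau ->
  stable tau e1 -> unstable tau (x -v e1) ->
  stable tau e2 -> unstable tau (x -v e2) -> e1 = e2.
Proof.
intros Htau S1 U1 S2 U2. apply vsub_eq0, (stable_unstable_eq0 tau); [easy | |].
- now apply stable_sub.
- replace (e1 -v e2) with ((x -v e2) -v (x -v e1)) by vabel. now apply unstable_sub.
Qed.

(** The 16 collects 4 for the rounding to the grid, 2 for bounding [N] by the unstable part in the
    cone, and 2 for the loss over the last partial step. *)
Lemma unstable_growth t tau y : 1 <= t -> t <= tau -> unstable t y ->
  N t y <= 16 * Rpower (tau / t) (- (ln 4 / ln h)) * unorm tau (U tau t y).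
Proof.
intros Ht Htau Hy.
destruct (scale_cover h 4 t tau) as [n [Hn Hp]]; try lra.
pose proof (grid_ge t n Ht) as Hg. assert (Hg1 : 1 <= h ^ n * t) by lra.
pose proof (unstable_cone t y Ht Hy) as Hc.
generalize (sn_ge0 (snorm_sn t Ht) y) (N_le_snorm_unorm t y Ht). intros Hal HN'.
destruct (cone_expand n t y Ht) as [H1 H2]; [lra|].
set (z := U (h ^ n * t) t y) in *.
generalize (unorm_U tau (h ^ n * t) z Hg1 Hn). unfold z at 4. rewrite U_comp by lra. intro H3.
rewrite Rpower_Ropp.
set (r := Rpower (tau / t) (ln 4 / ln h)) in *.
assert (H4 : 0 < 4 ^ n) by (apply pow_lt; lra).
assert (Hr : 0 < r) by (unfold r, Rpower; apply exp_pos).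
apply Rmult_le_reg_l with r; [easy|].
replace (r * (16 * / r * unorm tau (U tau t y))) with (16 * unorm tau (U tau t y))
  by (field; lra).
assert (r * N t y <= 4 * 4 ^ n * (2 * unorm t y)).
{ apply Rmult_le_compat; try lra. now apply sn_ge0, HN. }
generalize (sn_ge0 (unorm_sn _ Hg1) z). lra.
Qed.

(** * The dichotomy obtained from the cones *)

Lemma strong_npd_of_cones eps C : 0 < C ->
  (forall t x, 1 <= t -> N t x <= C * Rpower t eps * vnorm X x) ->
  strong_npd U eps.
Proof.
intros HC HNC.
assert (Hex : forall t x, exists e, 1 <= t -> stable t e /\ unstable t (x -v e)).
{ intros t x. destruct (Rle_dec 1 t) as [Ht|]; [|now exists x].
  destruct (splitting t x Ht) as [f [Ff Hf]]. exists (x -v f). intros _. split; [easy|].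
  now replace (x -v (x -v f)) with f by vabel. }
pose (E := fun t x => proj1_sig (constructive_indefinite_description _ (Hex t x))).
assert (E_stable : forall t x, 1 <= t -> stable t (E t x)).
{ intros t x. apply (proj2_sig (constructive_indefinite_description _ (Hex t x))). }
assert (E_unstable : forall t x, 1 <= t -> unstable t (x -v E t x)).
{ intros t x. apply (proj2_sig (constructive_indefinite_description _ (Hex t x))). }
clearbody E.
assert (E_unique : forall t x e, 1 <= t -> stable t e -> unstable t (x -v e) -> E t x = e).
{ intros t x e Ht Se Ue. apply (split_unique t x); auto. }
assert (stable0 : forall t, 1 <= t -> stable t vzero).
{ intros t Ht. replace (@vzero X) with (E t vzero -v E t vzero) by vabel.
  apply stable_sub; auto. }
assert (unstable0 : forall t, 1 <= t -> unstable t vzero).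
{ intros t Ht. replace (@vzero X) with ((vzero -v E t vzero) -v (vzero -v E t vzero)) by vabel.
  apply unstable_sub; auto. }
assert (E_ker : forall t x, 1 <= t -> E t x = vzero -> unstable t x).
{ intros t x Ht H. generalize (E_unstable t x Ht). rewrite H.
  now replace (x -v vzero) with x by vabel. }
assert (ker_E : forall t x, 1 <= t -> unstable t x -> E t x = vzero).
{ intros t x Ht H. apply E_unique; auto.
  now replace (x -v vzero) with x by vabel. }
(* The 6 is the 2 of [split_bound] times the 3 of [snorm_unorm_le_N]. *)
assert (E_bound : forall t x, 1 <= t ->
  snorm t (E t x) <= 6 * C * Rpower t eps * vnorm X x /\
  unorm t (x -v E t x) <= 6 * C * Rpower t eps * vnorm X x).
{ intros t x Ht. destruct (split_bound t x (x -v E t x) Ht) as [H1 H2]; auto.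
  - replace (x -v (x -v E t x)) with (E t x) by vabel. now apply stable_cone; auto.
  - replace (x -v (x -v E t x)) with (E t x) in H2 by vabel.
    generalize (snorm_unorm_le_N t x Ht) (HNC t x Ht). lra. }
assert (E_sub : forall t x y, 1 <= t -> E t (x -v y) = E t x -v E t y).
{ intros t x y Ht. apply E_unique; auto.
  - apply stable_sub; auto.
  - replace (x -v y -v (E t x -v E t y)) with ((x -v E t x) -v (y -v E t y)) by vabel.
    apply unstable_sub; auto. }
assert (E_scal : forall t a x, 1 <= t -> E t (vscal X a x) = vscal X a (E t x)).
{ intros t a x Ht. apply E_unique; auto.
  - destruct (E_stable t x Ht) as [M HM]. exists (Rabs a * M). intros s Hs.
    assert (Hs1 : 1 <= s) by lra.
    rewrite (lin_scal (U_lin s t Ht Hs)). eapply Rle_trans; [apply (sn_scal (HN s Hs1))|].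
    apply Rmult_le_compat_l; [apply Rabs_pos|auto].
  - rewrite <- vscal_sub. destruct (E_unstable t x Ht) as [y [Py ->]].
    exists (vscal X a y). split.
    + rewrite (lin_scal (proj1 (HP 1 (Rle_refl 1)))), Py.
      replace (@vzero X) with (vscal X 0 y) by apply vscal_0.
      rewrite vscal_assoc. f_equal. ring.
    + now rewrite (lin_scal (U_lin t 1 (Rle_refl 1) Ht)). }
assert (E_lin : forall t, 1 <= t -> bounded_linear (E t)).
{ intros t Ht. split; [|split].
  - intros x y. replace (x +v y) with (x -v (vzero -v y)) by vabel.
    rewrite !E_sub, (ker_E t vzero) by auto. vabel.
  - intros a x. now apply E_scal.
  - exists (2 * (6 * C * Rpower t eps)). intro x.
    generalize (E_bound t x Ht) (stable_cone t (E t x) Ht (E_stable t x Ht))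
      (N_le_snorm_unorm t (E t x) Ht) (vnorm_le_N t (E t x) Ht). lra. }
assert (Hlnh : 0 < ln h) by (rewrite <- ln_1; apply ln_increasing; lra).
assert (Hln4 : 0 < ln 4) by (rewrite <- ln_1; apply ln_increasing; lra).
assert (HlnG : 0 < ln G) by (rewrite <- ln_1; apply ln_increasing; lra).
assert (Rp_pos : forall a b, 0 < Rpower a b) by (intros; apply exp_pos).
split.
(* The exponent turns a factor 4 per step into a power. The stable estimate costs
   [4 * 2 * G * 6 * C], the unstable one [16 * 6 * C]; as [G > 1], the constant [96 * G * C] covers
   both. *)
- exists E, (ln 4 / ln h), (96 * G * C).
  split; [now apply Rdiv_lt_0_compat|].
  split; [apply Rmult_lt_0_compat; lra|].
  split; [|split; [|split; [|split]]].
  + intros t Ht. split; [auto|]. intro x. apply E_unique; auto.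
    replace (E t x -v E t x) with (@vzero X) by vabel. auto.
  + intros t tau x Htau Ht. assert (Ht1 : 1 <= t) by lra. apply E_unique; auto.
    * apply stable_U; auto.
    * rewrite <- (lin_sub (U_lin t tau Htau Ht)). apply unstable_U; auto.
  + intros t tau Htau Ht. assert (Ht1 : 1 <= t) by lra. split.
    (* Injectivity is [unstable_growth] for a vector with zero image. *)
    * intros x1 x2 H1 H2 H. apply vsub_eq0, vnorm_eq0, Rle_antisym; [|apply vnorm_nonneg].
      assert (Hu : unstable tau (x1 -v x2)) by (apply unstable_sub; auto).
      generalize (unstable_growth tau t _ Htau Ht Hu) (vnorm_le_N tau (x1 -v x2) Htau).
      rewrite (lin_sub (U_lin t tau Htau Ht)), H.
      unfold vsub at 2. rewrite vadd_opp, (sn_0 (unorm_sn t Ht1)). lra.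
    * intros y Hy. destruct (unstable_lift t tau y) as [x [Hx Hxy]]; auto.
      exists x. split; auto.
  + intros t tau x Htau Ht. assert (Ht1 : 1 <= t) by lra.
    destruct (scale_cover h 4 tau t) as [n [Hn Hp]]; try lra.
    pose proof (grid_ge tau n Htau) as Hg. assert (Hg1 : 1 <= h ^ n * tau) by lra.
    assert (Hd : 4 ^ n * N t (U t tau (E tau x)) <= 2 * G * snorm tau (E tau x)).
    { apply stable_decay; try easy. apply stable_cone; [easy|].
      apply stable_U; [easy | lra | auto]. }
    destruct (E_bound tau x Htau) as [Hb _].
    generalize (vnorm_le_N t (U t tau (E tau x)) Ht1). intro Hv.
    rewrite Rpower_Ropp. set (r := Rpower (t / tau) (ln 4 / ln h)) in *.
    assert (Hr : 0 < r) by apply Rp_pos.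
    apply Rmult_le_reg_l with r; [easy|].
    replace (r * (96 * G * C * / r * Rpower tau eps * vnorm X x))
      with (8 * G * (12 * C * Rpower tau eps * vnorm X x)) by (field; lra).
    assert (r * vnorm X (U t tau (E tau x)) <= 4 * 4 ^ n * N t (U t tau (E tau x))).
    { apply Rmult_le_compat; try lra. apply vnorm_nonneg. }
    assert (8 * G * snorm tau (E tau x) <= 8 * G * (6 * C * Rpower tau eps * vnorm X x))
      by (apply Rmult_le_compat_l; lra).
    assert (0 <= G * (C * Rpower tau eps * vnorm X x)).
    { repeat apply Rmult_le_pos; try lra; [apply Rlt_le, Rp_pos | apply vnorm_nonneg]. }
    lra.
  + intros t tau x y Ht Htau Hy HUy. assert (Htau1 : 1 <= tau) by lra.
    generalize (unstable_growth t tau y Ht Htau (E_ker t y Ht Hy)) (vnorm_le_N t y Ht).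
    rewrite HUy. destruct (E_bound tau x Htau1) as [_ Hb].
    set (r := Rpower (tau / t) (- (ln 4 / ln h))) in *.
    assert (Hr : 0 < r) by apply Rp_pos. intros H1 H2.
    assert (H3 : 16 * r * unorm tau (x -v E tau x)
                 <= 16 * r * (6 * C * Rpower tau eps * vnorm X x))
      by (apply Rmult_le_compat_l; lra).
    assert (H4 : 1 * (96 * r * (C * Rpower tau eps * vnorm X x))
                 <= G * (96 * r * (C * Rpower tau eps * vnorm X x))).
    { apply Rmult_le_compat_r; [|lra].
      repeat apply Rmult_le_pos; try lra; [apply Rlt_le, Rp_pos | apply vnorm_nonneg]. }
    lra.
(* Each full step costs [G], which gives the exponent; the extra [G] is for the partial step and [C]
   for comparing norms. *)
- exists (G * C), (ln G / ln h).
  split; [apply Rmult_lt_0_compat; lra|]. split; [now apply Rdiv_lt_0_compat|].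
  intros t tau x Htau Ht. assert (Ht1 : 1 <= t) by lra.
  destruct (scale_cover h G tau t) as [n [Hn Hp]]; try lra.
  pose proof (grid_ge tau n Htau) as Hg. assert (Hg1 : 1 <= h ^ n * tau) by lra.
  assert (Hgrow : forall m, N (h ^ m * tau) (U (h ^ m * tau) tau x) <= G ^ m * N tau x).
  { induction m as [|m IH].
    - simpl pow. rewrite !Rmult_1_l, U_id by easy. lra.
    - pose proof (grid_ge tau m Htau) as Hm. assert (Hm1 : 1 <= h ^ m * tau) by lra.
      rewrite <- U_grid_last by easy.
      replace (h ^ S m * tau) with (h * (h ^ m * tau)) by (simpl; ring).
      eapply Rle_trans; [apply N_U; [easy | generalize (step_ge _ Hm1); lra]|].
      simpl. rewrite Rmult_assoc. apply Rmult_le_compat_l; [lra|easy]. }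
  eapply Rle_trans; [apply (vnorm_le_N t _ Ht1)|].
  rewrite <- (U_comp t (h ^ n * tau) tau) by lra.
  eapply Rle_trans; [apply N_U; easy|].
  rewrite !(Rmult_assoc G). apply Rmult_le_compat_l; [lra|].
  eapply Rle_trans; [apply Hgrow|].
  apply Rle_trans with (Rpower (t / tau) (ln G / ln h) * (C * Rpower tau eps * vnorm X x)).
  + apply Rmult_le_compat; [apply pow_le; lra | now apply sn_ge0, HN | lra | auto].
  + right; ring.
Qed.
End Cones.

(** * Small perturbations in an adapted norm *)

Lemma continuous_from_bounded {X : Banach} (g : R -> X) a b :
  a <= b -> continuous_from g a -> exists M, forall s, a <= s <= b -> vnorm X (g s) <= M.
Proof.
intros Hab Hg. pose proof (cseminorm_vnorm X) as HV.
(* Composing with [Rmax a] extends [g] by a constant to the left of [a], which provides two-sided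
   continuity at the endpoint. *)
destruct (continuity_ab_maj (fun s => vnorm X (g (Rmax a s))) a b Hab) as [m [Hm _]].
- intros s0 Hs0 e He.
  destruct (Hg s0 (proj1 Hs0) e He) as [d [Hd H]].
  exists d. split; [easy|]. intros s [_ Hs]. simpl in *. unfold Rdist in *.
  rewrite (Rmax_right a s0) by lra.
  assert (Hmax : Rabs (Rmax a s - s0) < d).
  { unfold Rmax. destruct (Rle_dec a s); [easy|].
    revert Hs. unfold Rabs. repeat destruct Rcase_abs; lra. }
  specialize (H (Rmax a s) (Rmax_l a s) Hmax).
  generalize (sn_sub_rev HV (g (Rmax a s)) (g s0)) (sn_sub_rev HV (g s0) (g (Rmax a s)))
    (sn_sym HV (g s0) (g (Rmax a s))).
  intros. unfold Rabs. destruct Rcase_abs; lra.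
- exists (vnorm X (g (Rmax a m))). intros s Hs. specialize (Hm s Hs).
  simpl in Hm. now rewrite (Rmax_right a s) in Hm by lra.
Qed.

(** Iterating [S -> a + S / 2] from any finite bound [S0] converges to the fixed point [2 * a]. *)
Lemma absorb_half (f : R -> R) (I : R -> Prop) a S0 :
  (forall s, I s -> f s <= S0) ->
  (forall S, (forall s, I s -> f s <= S) -> forall s, I s -> f s <= a + S / 2) ->
  forall s, I s -> f s <= 2 * a.
Proof.
intros H0 H s Hs.
assert (Hn : forall n s, I s -> f s <= 2 * a + (S0 - 2 * a) * (1 / 2) ^ n).
{ induction n as [|n IH]; intros r Hr.
  - specialize (H0 r Hr). simpl. lra.
  - specialize (H _ IH r Hr). simpl. lra. }
apply Rminus_le, le0_of_geometric with (S0 - 2 * a). intro n. specialize (Hn n s Hs). lra.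
Qed.

(** The interface between the construction of the norm and the perturbation argument: the dichotomy
    estimates are uniform, and all nonuniformity is confined to [an_le]. *)
Record adapted_norm {X : Banach} (T : R -> R -> X -> X) (P : R -> X -> X)
    (N : R -> X -> R) (lam b C eps : R) : Prop := {
  an_lam : 0 < lam;
  an_b : 0 < b;
  an_C : 0 < C;
  an_P : forall t, 1 <= t -> bounded_linear (P t) /\ forall x, P t (P t x) = P t x;
  an_comm : forall t tau x, 1 <= tau -> tau <= t -> P t (T t tau x) = T t tau (P tau x);
  an_onto : forall t tau y, 1 <= tau -> tau <= t -> P t y = vzero ->
    exists x, P tau x = vzero /\ T t tau x = y;
  an_sn : forall t, 1 <= t -> cseminorm (N t);
  an_ge : forall t x, 1 <= t -> vnorm X x <= N t x;
  an_le : forall t x, 1 <= t -> N t x <= C * Rpower t eps * vnorm X x;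
  an_stable : forall t tau x, 1 <= tau -> tau <= t ->
    N t (T t tau (P tau x)) <= Rpower (t / tau) (- lam) * N tau x;
  an_unstable : forall t tau y, 1 <= tau -> tau <= t -> P tau y = vzero ->
    N tau y <= Rpower (t / tau) (- lam) * N t (T t tau y);
  an_growth : forall t tau x, 1 <= tau -> tau <= t ->
    N t (T t tau x) <= 2 * Rpower (t / tau) b * N tau x
}.

Arguments an_lam {X T P N lam b C eps}.
Arguments an_b {X T P N lam b C eps}.
Arguments an_C {X T P N lam b C eps}.
Arguments an_P {X T P N lam b C eps}.
Arguments an_comm {X T P N lam b C eps}.
Arguments an_onto {X T P N lam b C eps}.
Arguments an_sn {X T P N lam b C eps}.
Arguments an_ge {X T P N lam b C eps}.
Arguments an_le {X T P N lam b C eps}.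
Arguments an_stable {X T P N lam b C eps}.
Arguments an_unstable {X T P N lam b C eps}.
Arguments an_growth {X T P N lam b C eps}.

Section Perturbation.
Context {X : Banach} {T : R -> R -> X -> X} {P : R -> X -> X} {N : R -> X -> R}.
Context {lam b C eps : R}.
Hypothesis HT : evolution_family T.
Hypothesis HA : adapted_norm T P N lam b C eps.

(** [H] bounds the power growth of [T] within one step. [k] multiplies [c] in the size of the
    perturbing integral: [2 * H] from the growth, [C] from the norm of [B], and [h] as a bound for
    [(t - tau) / tau]. *)
Let h := Rpower 16 (/ lam).
Let H := Rpower h b.
Let k := 2 * H * C * h.

Lemma h_gt1 : 1 < h.
Proof.
unfold h. rewrite <- (Rpower_O 16) by lra. apply Rpower_lt; [lra|].
apply Rinv_0_lt_compat, (an_lam HA).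
Qed.

Lemma h_lam : Rpower h lam = 16.
Proof.
unfold h. rewrite Rpower_mult, Rinv_l, Rpower_1; [easy | lra |].
generalize (an_lam HA). lra.
Qed.

Lemma H_ge1 : 1 <= H.
Proof.
generalize h_gt1 (an_b HA). intros. apply Rpower_ge1; lra.
Qed.

Lemma k_pos : 0 < k.
Proof.
generalize h_gt1 H_ge1 (an_C HA). intros. unfold k. repeat apply Rmult_lt_0_compat; lra.
Qed.

Lemma ratio_le_H t tau : 1 <= tau -> tau <= t <= h * tau -> Rpower (t / tau) b <= H.
Proof.
intros Htau Ht. apply Rle_Rpower_l; [generalize (an_b HA); lra|]. split.
- apply Rdiv_lt_0_compat; lra.
- apply Rmult_le_reg_r with tau; [lra|].
  replace (t / tau * tau) with t by (field; lra). lra.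
Qed.

Lemma adapted_P t x : 1 <= t -> N t (P t x) <= N t x.
Proof.
intro Ht. generalize (an_stable HA t t x Ht (Rle_refl t)).
replace (t / t) with 1 by (field; lra). destruct HT as [_ [Tid _]]. rewrite Tid by easy.
unfold Rpower. rewrite ln_1, Rmult_0_r, exp_0. lra.
Qed.

Section Perturbed.
Context {c : R} {B : R -> X -> X} {U : R -> R -> X -> X}.
Hypothesis c_pos : 0 < c.
Hypothesis HB : forall t x, 1 <= t ->
  vnorm X (B t x) <= c / Rpower t (1 + eps) * vnorm X x.
Hypothesis HU : evolution_family U.
Hypothesis Hint : forall t tau x, 1 <= tau -> tau <= t ->
  is_RInt (fun s => T t s (B s (U s tau x))) tau t (U t tau x -v T t tau x).

Lemma adapted_B t x : 1 <= t -> N t (B t x) <= C * (c / t) * N t x.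
Proof.
intro Ht. eapply Rle_trans; [apply (an_le HA); easy|].
assert (HC := an_C HA). assert (H0 : 0 < Rpower t eps) by apply Rpower_pos.
rewrite !Rmult_assoc. apply Rmult_le_compat_l; [lra|].
apply Rle_trans with (Rpower t eps * (c / Rpower t (1 + eps) * vnorm X x)).
- apply Rmult_le_compat_l; [lra|]. now apply HB.
- rewrite Rpower_plus, Rpower_1 by lra.
  replace (Rpower t eps * (c / (t * Rpower t eps) * vnorm X x))
    with (c / t * vnorm X x) by (field; lra).
  apply Rmult_le_compat_l; [apply Rlt_le, Rdiv_lt_0_compat; lra|].
  now apply (an_ge HA).
Qed.

(* The a priori bound [S] is removed in [adapted_U] through [absorb_half], which replaces
   Gronwall's inequality. *)
Lemma perturbation_le tau x S : 1 <= tau ->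
  (forall s, tau <= s <= h * tau -> N s (U s tau x) <= S) ->
  forall t, tau <= t <= h * tau -> N t (U t tau x -v T t tau x) <= c * k * S.
Proof.
intros Htau HS t Ht. assert (Ht1 : 1 <= t) by lra.
assert (HC := an_C HA). assert (Hh := h_gt1). assert (HH := H_ge1).
assert (HS0 : 0 <= S).
{ eapply Rle_trans; [|apply (HS tau); lra]. now apply sn_ge0, (an_sn HA). }
apply Rle_trans with (2 * H * (C * (c / tau) * S) * (t - tau)).
- apply (sn_RInt_le (an_sn HA t Ht1) _ tau t _ _ (proj1 Ht) (Hint t tau x Htau (proj1 Ht))).
  intros s Hs. assert (Hs1 : 1 <= s) by lra.
  eapply Rle_trans; [apply (an_growth HA); lra|].
  assert (Hr : Rpower (t / s) b <= H).
  { apply ratio_le_H; [lra|]. split; [lra|]. apply Rle_trans with (h * tau); [lra|].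
    apply Rmult_le_compat_l; lra. }
  apply Rmult_le_compat.
  + generalize (Rpower_pos (t / s) b). lra.
  + now apply sn_ge0, (an_sn HA).
  + lra.
  + eapply Rle_trans; [now apply adapted_B|].
    apply Rmult_le_compat.
    * apply Rmult_le_pos; [lra|]. apply Rlt_le, Rdiv_lt_0_compat; lra.
    * now apply sn_ge0, (an_sn HA).
    * apply Rmult_le_compat_l; [lra|]. apply Rmult_le_compat_l; [lra|].
      apply Rinv_le_contravar; lra.
    * apply HS. lra.
- replace (2 * H * (C * (c / tau) * S) * (t - tau))
    with (c * (2 * H * C) * S * ((t - tau) / tau)) by (field; lra).
  replace (c * k * S) with (c * (2 * H * C) * S * h) by (unfold k; ring).
  apply Rmult_le_compat_l; [repeat apply Rmult_le_pos; lra|].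
  apply Rmult_le_reg_r with tau; [lra|].
  replace ((t - tau) / tau * tau) with (t - tau) by (field; lra). lra.
Qed.

Hypothesis c_small : c * (k * (4 * H)) <= 1 / 32.

Lemma adapted_U t tau x : 1 <= tau -> tau <= t <= h * tau ->
  N t (U t tau x) <= 4 * H * N tau x.
Proof.
intros Htau Ht. assert (Hh := h_gt1). assert (HH := H_ge1). assert (Hk := k_pos).
assert (Hck : c * k <= 1 / 2).
{ assert (c * k * 1 <= c * k * (4 * H)).
  { apply Rmult_le_compat_l; [apply Rmult_le_pos; lra | lra]. } lra. }
replace (4 * H * N tau x) with (2 * (2 * H * N tau x)) by ring.
assert (Hht : tau <= h * tau) by lra.
destruct (continuous_from_bounded (fun s => U s tau x) tau (h * tau) Hht) as [M HM].
{ now apply HU. }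
(* The a priori bound comes from continuity of the orbit on a compact interval; the exponent
   [Rabs eps] makes the power monotone in [s]. *)
apply (absorb_half (fun s => N s (U s tau x)) (fun s => tau <= s <= h * tau) _
  (C * Rpower (h * tau) (Rabs eps) * M)); [| |easy].
- intros s Hs. assert (Hs1 : 1 <= s) by lra.
  eapply Rle_trans; [now apply (an_le HA)|].
  assert (Rpower s eps <= Rpower (h * tau) (Rabs eps)).
  { apply Rle_trans with (Rpower s (Rabs eps)).
    - apply Rle_Rpower; [lra | apply RRle_abs].
    - apply Rle_Rpower_l; [apply Rabs_pos | lra]. }
  assert (HC := an_C HA). generalize (Rpower_pos s eps). intro.
  apply Rmult_le_compat.
  + apply Rmult_le_pos; lra.
  + apply vnorm_nonneg.
  + apply Rmult_le_compat_l; lra.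
  + now apply HM.
- intros S HS s Hs. assert (Hs1 : 1 <= s) by lra.
  assert (HS0 : 0 <= S).
  { eapply Rle_trans; [|apply (HS s); lra]. now apply sn_ge0, (an_sn HA). }
  generalize (perturbation_le tau x S Htau HS s Hs)
    (sn_sub_rev (an_sn HA s Hs1) (U s tau x) (T s tau x))
    (an_growth HA s tau x Htau (proj1 Hs)).
  assert (c * k * S <= 1 / 2 * S) by (apply Rmult_le_compat_r; lra).
  assert (2 * Rpower (s / tau) b * N tau x <= 2 * H * N tau x).
  { apply Rmult_le_compat_r; [now apply sn_ge0, (an_sn HA)|].
    generalize (ratio_le_H s tau Htau Hs). lra. }
  lra.
Qed.

Lemma perturbation_small t tau x : 1 <= tau -> tau <= t <= h * tau ->
  N t (U t tau x -v T t tau x) <= N tau x / 32.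
Proof.
intros Htau Ht.
eapply Rle_trans.
{ apply (perturbation_le tau x (4 * H * N tau x)); [easy | | easy].
  intros s Hs. now apply adapted_U. }
replace (c * k * (4 * H * N tau x)) with (c * (k * (4 * H)) * N tau x) by ring.
replace (N tau x / 32) with (1 / 32 * N tau x) by field.
apply Rmult_le_compat_r; [now apply sn_ge0, (an_sn HA)|easy].
Qed.

(** Removing the [P] component at most doubles the norm, so the [1 / 32] of [perturbation_small]
    becomes [1 / 16]. *)
Lemma perturbation_snorm_unorm t tau x : 1 <= tau -> tau <= t <= h * tau ->
  N t (P t (U t tau x -v T t tau x)) <=
    (N tau (P tau x) + N tau (x -v P tau x)) / 16 /\
  N t ((U t tau x -v T t tau x) -v P t (U t tau x -v T t tau x)) <=
    (N tau (P tau x) + N tau (x -v P tau x)) / 16.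
Proof.
intros Htau Ht. assert (Ht1 : 1 <= t) by lra.
generalize (perturbation_small t tau x Htau Ht).
set (d := U t tau x -v T t tau x). intro Hd.
generalize (adapted_P t d Ht1) (sn_sub (an_sn HA t Ht1) d (P t d))
  (sn_add (an_sn HA tau Htau) (P tau x) (x -v P tau x)) (sn_ge0 (an_sn HA t Ht1) d).
replace (P tau x +v (x -v P tau x)) with x by vabel. lra.
Qed.

Lemma strong_npd_perturbed : strong_npd U eps.
Proof.
assert (Hh := h_gt1). assert (HH := H_ge1). assert (Hlam := an_lam HA).
assert (T_lin : forall t tau, 1 <= tau -> tau <= t -> bounded_linear (T t tau)) by apply HT.
assert (TQ : forall t tau x, 1 <= tau -> tau <= t ->
  T t tau x -v P t (T t tau x) = T t tau (x -v P tau x)).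
{ intros t tau x Htau Ht. now rewrite (lin_sub (T_lin t tau Htau Ht)), (an_comm HA). }
assert (PQ : forall t x, 1 <= t -> P t (x -v P t x) = vzero).
{ intros t x Ht. destruct (an_P HA t Ht) as [HL Hid]. rewrite (lin_sub HL), Hid. vabel. }
assert (alU : forall t tau x, 1 <= tau -> tau <= t <= h * tau ->
  N t (P t (U t tau x)) <= Rpower (t / tau) (- lam) * N tau (P tau x)
     + (N tau (P tau x) + N tau (x -v P tau x)) / 16).
{ intros t tau x Htau Ht. assert (Ht1 : 1 <= t) by lra.
  destruct (perturbation_snorm_unorm t tau x Htau Ht) as [H1 _].
  rewrite (lin_sub (proj1 (an_P HA t Ht1))) in H1.
  generalize (sn_sub_rev (an_sn HA t Ht1) (P t (U t tau x)) (P t (T t tau x)))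
    (an_stable HA t tau (P tau x) Htau (proj1 Ht)).
  rewrite (proj2 (an_P HA tau Htau)), <- (an_comm HA) by easy. lra. }
(* [an_unstable], read backwards, is expansion of the unstable part by [T]; the reverse triangle
   inequality then subtracts the perturbation. *)
assert (beU : forall t tau x, 1 <= tau -> tau <= t <= h * tau ->
  Rpower (t / tau) lam * N tau (x -v P tau x)
     - (N tau (P tau x) + N tau (x -v P tau x)) / 16
  <= N t (U t tau x -v P t (U t tau x))).
{ intros t tau x Htau Ht. assert (Ht1 : 1 <= t) by lra.
  destruct (perturbation_snorm_unorm t tau x Htau Ht) as [_ H1].
  rewrite (lin_sub (proj1 (an_P HA t Ht1))) in H1.
  replace (U t tau x -v T t tau x -v (P t (U t tau x) -v P t (T t tau x)))
    with ((U t tau x -v P t (U t tau x)) -v (T t tau x -v P t (T t tau x))) in H1 by vabel.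
  generalize (sn_sub_rev (an_sn HA t Ht1) (T t tau x -v P t (T t tau x))
                (U t tau x -v P t (U t tau x)))
    (sn_sym (an_sn HA t Ht1) (T t tau x -v P t (T t tau x))
                (U t tau x -v P t (U t tau x))).
  intros H2 H3.
  generalize (an_unstable HA t tau _ Htau (proj1 Ht) (PQ tau x Htau)). rewrite <- TQ by easy.
  intro H4. apply Rmult_le_compat_l with (r := Rpower (t / tau) lam) in H4;
    [|apply Rlt_le, Rpower_pos].
  rewrite <- Rmult_assoc, (Rmult_comm _ (Rpower _ (- lam))), Rpower_opp_l in H4. lra. }
assert (step_ratio : forall tau, 1 <= tau -> h * tau / tau = h).
{ intros. field. lra. }
apply (@strong_npd_of_cones X U P N h (4 * H)) with (C := C).
- exact h_gt1.
- lra.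
- exact HU.
- apply (an_P HA).
- apply (an_sn HA).
- apply (an_ge HA).
- apply adapted_P.
- apply adapted_U.
- intros t tau x Htau Ht. unfold snorm, unorm. eapply Rle_trans; [now apply alU|].
  apply Rplus_le_compat_r. rewrite <- (Rmult_1_l (N tau (P tau x))) at 2.
  apply Rmult_le_compat_r; [now apply sn_ge0, (an_sn HA)|].
  apply Rpower_neg_le1; [apply ratio_ge1|]; lra.
- intros t tau x Htau Ht. unfold snorm, unorm. eapply Rle_trans; [|now apply beU].
  apply Rplus_le_compat_r. rewrite <- (Rmult_1_l (N tau (x -v P tau x))) at 1.
  apply Rmult_le_compat_r; [now apply sn_ge0, (an_sn HA)|].
  apply Rpower_ge1; [apply ratio_ge1|]; lra.
- intros tau x Htau. unfold snorm, unorm.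
  eapply Rle_trans; [apply alU; [easy|]|].
  { split; [|lra]. rewrite <- (Rmult_1_l tau) at 1. apply Rmult_le_compat_r; lra. }
  rewrite step_ratio, Rpower_Ropp, h_lam by easy. lra.
- intros tau x Htau. unfold snorm, unorm.
  eapply Rle_trans; [|apply beU; [easy|]].
  { rewrite step_ratio, h_lam by easy. lra. }
  split; [|lra]. rewrite <- (Rmult_1_l tau) at 1. apply Rmult_le_compat_r; lra.
(* With [y] the preimage under [T], the vector [z] is the unstable part of [T t tau x], so the error
   is exactly that of the perturbation. *)
- intros t tau z Htau Ht Pz. assert (Ht1 : 1 <= t) by lra.
  destruct (an_onto HA t tau z Htau (proj1 Ht) Pz) as [y [Py Hy]].
  exists y. split; [easy|]. split.
  + eapply Rle_trans; [apply (an_unstable HA t tau); try easy; apply Ht|].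
    rewrite Hy. rewrite <- (Rmult_1_l (N t z)) at 2.
    apply Rmult_le_compat_r; [now apply sn_ge0, (an_sn HA)|].
    apply Rpower_neg_le1; [apply ratio_ge1|]; lra.
  + intros x Hx. unfold snorm, unorm.
    destruct (perturbation_snorm_unorm t tau x Htau Ht) as [_ H1].
    eapply Rle_trans; [|exact H1]. right. f_equal.
    rewrite (lin_sub (proj1 (an_P HA t Ht1))), <- Hy, <- Hx, <- TQ by easy. vabel.
- apply (an_C HA).
- apply (an_le HA).
Qed.
End Perturbed.
End Perturbation.

(** * The Lyapunov norm *)

Section Lyapunov.
Context {X : Banach} {T : R -> R -> X -> X} {P : R -> X -> X}.
Context {lam b D K eps : R}.
Hypothesis HT : evolution_family T.
Hypothesis lam_pos : 0 < lam.
Hypothesis lam_le_b : lam <= b.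
Hypothesis D_pos : 0 < D.
Hypothesis K_pos : 0 < K.
Hypothesis HP : forall t, 1 <= t -> bounded_linear (P t) /\ forall x, P t (P t x) = P t x.
Hypothesis comm : forall t tau x, 1 <= tau -> tau <= t -> P t (T t tau x) = T t tau (P tau x).
Hypothesis inj : forall t tau, 1 <= tau -> tau <= t -> forall x1 x2,
  P tau x1 = vzero -> P tau x2 = vzero -> T t tau x1 = T t tau x2 -> x1 = x2.
Hypothesis onto : forall t tau y, 1 <= tau -> tau <= t -> P t y = vzero ->
  exists x, P tau x = vzero /\ T t tau x = y.
Hypothesis stable_bound : forall t tau x, 1 <= tau -> tau <= t ->
  vnorm X (T t tau (P tau x)) <= D * Rpower (t / tau) (- lam) * Rpower tau eps * vnorm X x.
Hypothesis unstable_bound : forall t tau x y, 1 <= t -> t <= tau ->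
  P t y = vzero -> T tau t y = vsub x (P tau x) ->
  vnorm X y <= D * Rpower (tau / t) (- lam) * Rpower tau eps * vnorm X x.
Hypothesis growth_bound : forall t tau x, 1 <= tau -> tau <= t ->
  vnorm X (T t tau x) <= K * Rpower (t / tau) b * Rpower tau eps * vnorm X x.

(** In the second family [y] stands for the backward image of the unstable part of [x],
    characterized by its forward image so that no inverse operator is named. *)
Inductive lyapunov_set (t : R) (x : X) : R -> Prop :=
| lyapunov_stable s : t <= s ->
    lyapunov_set t x (Rpower (s / t) lam * vnorm X (T s t (P t x)))
| lyapunov_unstable s y : 1 <= s -> s <= t -> P s y = vzero -> T t s y = x -v P t x ->
    lyapunov_set t x (Rpower (t / s) lam * vnorm X y)
| lyapunov_growth s : t <= s ->
    lyapunov_set t x (Rpower (s / t) (- b) * vnorm X (T s t x)).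

Lemma lyapunov_set_le t x : 1 <= t ->
  is_upper_bound (lyapunov_set t x) ((D + K) * Rpower t eps * vnorm X x).
Proof.
intros Ht.
assert (H0 : 0 <= Rpower t eps * vnorm X x)
  by (apply Rmult_le_pos; [apply Rlt_le, Rpower_pos | apply vnorm_nonneg]).
assert (HD : 0 <= D * (Rpower t eps * vnorm X x)) by (apply Rmult_le_pos; lra).
assert (HK : 0 <= K * (Rpower t eps * vnorm X x)) by (apply Rmult_le_pos; lra).
intros r Hr. destruct Hr as [s Hs | s y Hs1 Hs Py Hy | s Hs].
- apply Rle_trans with (D * (Rpower t eps * vnorm X x)); [|lra].
  apply Rpower_move. generalize (stable_bound s t x Ht Hs). lra.
- apply Rle_trans with (D * (Rpower t eps * vnorm X x)); [|lra].
  apply Rpower_move. generalize (unstable_bound s t x y Hs1 Hs Py Hy). lra.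
- apply Rle_trans with (K * (Rpower t eps * vnorm X x)); [|lra].
  apply Rpower_move. rewrite Ropp_involutive. generalize (growth_bound s t x Ht Hs). lra.
Qed.

Lemma lyapunov_norm_exists :
  exists N : R -> X -> R, forall t x, 1 <= t -> is_lub (lyapunov_set t x) (N t x).
Proof.
assert (Hex : forall t x, exists m, 1 <= t -> is_lub (lyapunov_set t x) m).
{ intros t x. destruct (Rle_dec 1 t) as [Ht|]; [|now exists 0].
  destruct (completeness (lyapunov_set t x)) as [m Hm].
  - eexists. now apply lyapunov_set_le.
  - eexists. apply (lyapunov_stable t x t). lra.
  - now exists m. }
exists (fun t x => proj1_sig (constructive_indefinite_description _ (Hex t x))).
intros t x. exact (proj2_sig (constructive_indefinite_description _ (Hex t x))).
Qed.

Lemma lyapunov_adapted (N : R -> X -> R) :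
  (forall t x, 1 <= t -> is_lub (lyapunov_set t x) (N t x)) ->
  adapted_norm T P N lam b (D + K) eps.
Proof.
intro HN.
assert (Nbound : forall t x, 1 <= t -> N t x <= (D + K) * Rpower t eps * vnorm X x).
{ intros t x Ht. now apply (HN t x Ht), lyapunov_set_le. }
destruct HT as [T_lin [T_id [T_comp _]]].
assert (HV := cseminorm_vnorm X).
(* [Ns], [Nu] and [Ng] express that [N] is an upper bound, one family at a time, and [Nle] that it
   is the least one. Everything below rests on these four. *)
assert (Ns : forall s t x, 1 <= t -> t <= s ->
  vnorm X (T s t (P t x)) <= Rpower (s / t) (- lam) * N t x).
{ intros s t x Ht Hs. apply Rpower_move, (HN t x Ht). now constructor. }
assert (Nu : forall s t x y, 1 <= s -> s <= t -> P s y = vzero -> T t s y = x -v P t x ->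
  vnorm X y <= Rpower (t / s) (- lam) * N t x).
{ intros s t x y Hs Ht Py Hy. assert (Ht1 : 1 <= t) by lra.
  apply Rpower_move, (HN t x Ht1). now constructor. }
assert (Ng : forall s t x, 1 <= t -> t <= s ->
  vnorm X (T s t x) <= Rpower (s / t) b * N t x).
{ intros s t x Ht Hs. rewrite <- (Ropp_involutive b).
  apply Rpower_move, (HN t x Ht). now constructor. }
assert (Nle : forall t x m, 1 <= t ->
  (forall s, t <= s -> vnorm X (T s t (P t x)) <= Rpower (s / t) (- lam) * m) ->
  (forall s y, 1 <= s -> s <= t -> P s y = vzero -> T t s y = x -v P t x ->
     vnorm X y <= Rpower (t / s) (- lam) * m) ->
  (forall s, t <= s -> vnorm X (T s t x) <= Rpower (s / t) b * m) ->
  N t x <= m).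
{ intros t x m Ht H1 H2 H3. apply (HN t x Ht). intros r Hr.
  destruct Hr as [s Hs | s y Hs1 Hs Py Hy | s Hs]; apply Rpower_move.
  - now apply H1.
  - now apply H2.
  - rewrite Ropp_involutive. now apply H3. }
clear HN.
assert (P_lin : forall t, 1 <= t -> bounded_linear (P t)) by apply HP.
assert (P_id : forall t x, 1 <= t -> P t (P t x) = P t x) by (intros; now apply HP).
assert (PQ : forall t x, 1 <= t -> P t (x -v P t x) = vzero).
{ intros t x Ht. rewrite (lin_sub (P_lin t Ht)), P_id by easy. vabel. }
assert (Pker : forall t tau y, 1 <= tau -> tau <= t -> P tau y = vzero ->
  P t (T t tau y) = vzero).
{ intros t tau y Htau Ht Py. rewrite comm, Py by easy. apply (lin_0 (T_lin t tau Htau Ht)). }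
assert (Nnorm : forall t x, 1 <= t -> vnorm X x <= N t x).
{ intros t x Ht. generalize (Ng t t x Ht (Rle_refl t)).
  rewrite T_id by easy. replace (t / t) with 1 by (field; lra).
  unfold Rpower. rewrite ln_1, Rmult_0_r, exp_0. lra. }
assert (N0 : forall t x, 1 <= t -> 0 <= N t x).
{ intros t x Ht. generalize (Nnorm t x Ht) (vnorm_nonneg X x). lra. }
constructor.
- easy.
- lra.
- lra.
- easy.
- easy.
- easy.
- intros t Ht. split; [|split].
  + intros x y. apply Nle; [easy | | |].
    * intros s Hs. rewrite (lin_add (P_lin t Ht)), (lin_add (T_lin s t Ht Hs)).
      generalize (vnorm_triangle X (T s t (P t x)) (T s t (P t y)))
        (Ns s t x Ht Hs) (Ns s t y Ht Hs). lra.
    * intros s z Hs Hst Pz Hz.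
      (* The backward image [z] for [x + y] is split into [z1], the one for [x], and [z - z1], which
         is then the one for [y]. *)
      destruct (onto t s (x -v P t x) Hs Hst (PQ t x Ht)) as [z1 [Pz1 Hz1]].
      assert (Pz2 : P s (z -v z1) = vzero).
      { rewrite (lin_sub (P_lin s Hs)), Pz, Pz1. vabel. }
      assert (Hz2 : T t s (z -v z1) = y -v P t y).
      { rewrite (lin_sub (T_lin t s Hs Hst)), Hz, Hz1, (lin_add (P_lin t Ht)). vabel. }
      generalize (sn_sub_rev HV z z1) (Nu s t x z1 Hs Hst Pz1 Hz1)
        (Nu s t y _ Hs Hst Pz2 Hz2). lra.
    * intros s Hs. rewrite (lin_add (T_lin s t Ht Hs)).
      generalize (vnorm_triangle X (T s t x) (T s t y))
        (Ng s t x Ht Hs) (Ng s t y Ht Hs). lra.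
  + intros a x. apply Nle; [easy | | |].
    * intros s Hs. rewrite (lin_scal (P_lin t Ht)), (lin_scal (T_lin s t Ht Hs)), vnorm_scal.
      rewrite (Rmult_comm (Rabs a)), (Rmult_comm (Rabs a)), <- Rmult_assoc.
      apply Rmult_le_compat_r; [apply Rabs_pos|]. now apply Ns.
    * intros s z Hs Hst Pz Hz.
      destruct (onto t s (x -v P t x) Hs Hst (PQ t x Ht)) as [z1 [Pz1 Hz1]].
      assert (z = vscal X a z1) as ->.
      { apply (inj t s Hs Hst); [easy | |].
        - rewrite (lin_scal (P_lin s Hs)), Pz1, <- (vscal_0 X z1), vscal_assoc.
          f_equal. ring.
        - rewrite (lin_scal (T_lin t s Hs Hst)), Hz1, Hz, vscal_sub.
          now rewrite (lin_scal (P_lin t Ht)). }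
      rewrite vnorm_scal.
      rewrite (Rmult_comm (Rabs a)), (Rmult_comm (Rabs a)), <- Rmult_assoc.
      apply Rmult_le_compat_r; [apply Rabs_pos|]. now apply Nu.
    * intros s Hs. rewrite (lin_scal (T_lin s t Ht Hs)), vnorm_scal.
      rewrite (Rmult_comm (Rabs a)), (Rmult_comm (Rabs a)), <- Rmult_assoc.
      apply Rmult_le_compat_r; [apply Rabs_pos|]. now apply Ng.
  + exists ((D + K) * Rpower t eps). split.
    { apply Rmult_le_pos; [lra | apply Rlt_le, Rpower_pos]. }
    intro x. now apply Nbound.
- easy.
- easy.
- intros t tau x Htau Ht. assert (Ht1 : 1 <= t) by lra. apply Nle; [easy | | |].
  + intros s Hs. rewrite comm, P_id, T_comp by lra.
    rewrite <- Rmult_assoc, Rpower_ratio by lra. apply Ns; lra.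
  + intros s y Hs Hst Py Hy.
    assert (y = vzero) as ->.
    { apply (inj t s Hs Hst); [easy | apply (lin_0 (P_lin s Hs)) |].
      rewrite Hy, comm, P_id, (lin_0 (T_lin t s Hs Hst)) by lra. vabel. }
    rewrite vnorm_zero. repeat apply Rmult_le_pos; try (apply Rlt_le, Rpower_pos); auto.
  + intros s Hs. rewrite T_comp by lra.
    eapply Rle_trans; [apply Ns; lra|].
    rewrite <- (Rpower_ratio s t tau) by lra. rewrite Rmult_assoc.
    apply Rmult_le_compat_r.
    { apply Rmult_le_pos; [apply Rlt_le, Rpower_pos | auto]. }
    apply Rle_Rpower; [apply ratio_ge1; lra | lra].
- intros t tau y Htau Ht Py. assert (Ht1 : 1 <= t) by lra.
  set (z := T t tau y).
  assert (Pz : P t z = vzero) by now apply Pker.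
  assert (Qz : z -v P t z = z) by (rewrite Pz; vabel).
  apply Nle; [easy | | |].
  + intros s Hs. rewrite Py, (lin_0 (T_lin s tau Htau Hs)), vnorm_zero.
    repeat apply Rmult_le_pos; try (apply Rlt_le, Rpower_pos); auto.
  + intros s y' Hs Hst Py' Hy'.
    rewrite <- Rmult_assoc, (Rmult_comm (Rpower _ _)), Rpower_ratio by lra.
    apply (Nu s t z y'); [lra | lra | easy |].
    rewrite Qz. unfold z. rewrite <- (T_comp t tau s) by lra.
    rewrite Hy', Py. f_equal. vabel.
  (* Up to time [t] the orbit of [y] is a backward orbit of [z], controlled by [Nu]; beyond [t] it
     is a forward orbit of [z], controlled by [Ng]. The condition [lam <= b] lets the growth weight
     absorb the decay factor still missing. *)
  + intros s Hs. destruct (Rle_dec s t) as [Hst|Hst].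
    * apply Rle_trans with (Rpower (t / s) (- lam) * N t z).
      { apply (Nu s t z); [lra | lra | apply Pker; easy |].
        rewrite Qz. apply T_comp; lra. }
      rewrite <- (Rpower_ratio t s tau) by lra.
      assert (Rpower (s / tau) b * Rpower (s / tau) (- lam) >= 1).
      { rewrite <- Rpower_plus. apply Rle_ge, Rpower_ge1; [apply ratio_ge1; lra | lra]. }
      rewrite <- Rmult_assoc. apply Rmult_le_compat_r; [auto|].
      rewrite <- (Rmult_1_r (Rpower (t / s) (- lam))) at 1.
      rewrite (Rmult_comm (Rpower (s / tau) b)), Rmult_assoc.
      apply Rmult_le_compat_l; [apply Rlt_le, Rpower_pos | lra].
    * apply Rle_trans with (Rpower (s / t) b * N t z).
      { unfold z. rewrite <- (T_comp s t tau) by lra. apply Ng; lra. }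
      rewrite <- (Rpower_ratio s t tau) by lra.
      assert (Rpower (t / tau) b * Rpower (t / tau) (- lam) >= 1).
      { rewrite <- Rpower_plus. apply Rle_ge, Rpower_ge1; [apply ratio_ge1; lra | lra]. }
      rewrite <- Rmult_assoc. apply Rmult_le_compat_r; [auto|].
      rewrite <- (Rmult_1_r (Rpower (s / t) b)) at 1. rewrite Rmult_assoc.
      apply Rmult_le_compat_l; [apply Rlt_le, Rpower_pos | lra].
- intros t tau x Htau Ht. assert (Ht1 : 1 <= t) by lra.
  assert (Hr : 1 <= Rpower (t / tau) b) by (apply Rpower_ge1; [apply ratio_ge1; lra | lra]).
  assert (HN0 := N0 tau x Htau).
  apply Nle; [easy | | |].
  + intros s Hs. rewrite comm, T_comp by lra.
    eapply Rle_trans; [apply Ns; lra|].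
    rewrite <- (Rpower_ratio s t tau) by lra. rewrite Rmult_assoc.
    apply Rmult_le_compat_l; [apply Rlt_le, Rpower_pos|].
    apply Rmult_le_compat_r; [easy|].
    assert (Rpower (t / tau) (- lam) <= 1)
      by (apply Rpower_neg_le1; [apply ratio_ge1; lra | lra]).
    lra.
  + intros s y Hs Hst Py Hy.
    assert (Hy' : T t s y = T t tau (x -v P tau x)).
    { rewrite Hy, comm, (lin_sub (T_lin t tau Htau Ht)) by easy. easy. }
    (* For [s <= tau], [y] already belongs to the backward orbit from time [tau]. For [s > tau] it
       is [T(s,tau)Q(tau)x], estimated as the difference of a growth term and a stable term; this is
       the origin of the factor 2 in [an_growth]. *)
    destruct (Rle_dec s tau) as [Hstau|Hstau].
    * assert (HTy : T tau s y = x -v P tau x).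
      { apply (inj t tau Htau Ht); [now apply Pker | now apply PQ |].
        rewrite T_comp by lra. exact Hy'. }
      eapply Rle_trans; [apply (Nu s tau x y); lra || easy|].
      rewrite <- (Rpower_ratio t tau s), (Rmult_comm (Rpower (t / tau) (- lam))) by lra.
      rewrite Rmult_assoc. apply Rmult_le_compat_l; [apply Rlt_le, Rpower_pos|].
      rewrite <- Rmult_assoc. rewrite <- (Rmult_1_l (N tau x)) at 1.
      apply Rmult_le_compat_r; [easy|].
      assert (Rpower (t / tau) (- lam) * Rpower (t / tau) b >= 1).
      { rewrite <- Rpower_plus. apply Rle_ge, Rpower_ge1; [apply ratio_ge1; lra | lra]. }
      lra.
    * assert (y = T s tau x -v T s tau (P tau x)) as ->.
      { rewrite <- (lin_sub (T_lin s tau Htau ltac:(lra))).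
        apply (inj t s Hs Hst); [easy | |].
        - apply Pker; [easy | lra | now apply PQ].
        - rewrite T_comp by lra. exact Hy'. }
      apply Rle_trans with (2 * Rpower (s / tau) b * N tau x).
      { assert (Rpower (s / tau) (- lam) * N tau x <= Rpower (s / tau) b * N tau x).
        { apply Rmult_le_compat_r; [easy|]. apply Rle_Rpower; [apply ratio_ge1; lra | lra]. }
        generalize (sn_sub HV (T s tau x) (T s tau (P tau x)))
          (Ng s tau x Htau ltac:(lra)) (Ns s tau x Htau ltac:(lra)). lra. }
      rewrite <- (Rpower_ratio t s tau) by lra.
      assert (Rpower (t / s) (- lam) * Rpower (t / s) b >= 1).
      { rewrite <- Rpower_plus. apply Rle_ge, Rpower_ge1; [apply ratio_ge1; lra | lra]. }
      replace (Rpower (t / s) (- lam) * (2 * (Rpower (t / s) b * Rpower (s / tau) b) * N tau x))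
        with (Rpower (t / s) (- lam) * Rpower (t / s) b * (2 * Rpower (s / tau) b * N tau x))
        by ring.
      rewrite <- (Rmult_1_l (2 * Rpower (s / tau) b * N tau x)) at 1.
      apply Rmult_le_compat_r; [|lra].
      apply Rmult_le_pos; [|easy]. generalize (Rpower_pos (s / tau) b). lra.
  + intros s Hs. rewrite T_comp by lra. eapply Rle_trans; [apply Ng; lra|].
    rewrite <- (Rpower_ratio s t tau) by lra.
    rewrite Rmult_assoc. apply Rmult_le_compat_l; [apply Rlt_le, Rpower_pos|].
    apply Rmult_le_compat_r; [easy|]. lra.
Qed.
End Lyapunov.

(** * Robustness of the strong dichotomy *)

Theorem theorem5p1 :
  forall (X : Banach) (T : R -> R -> X -> X) (eps : R),
    0 <= eps ->
    evolution_family T ->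
    strong_npd T eps ->
    exists c0, 0 < c0 /\
      forall (c : R) (B : R -> X -> X) (U : R -> R -> X -> X),
        0 < c -> c <= c0 ->
        (forall t, 1 <= t -> bounded_linear (B t)) ->
        (forall x, continuous_from (fun t => B t x) 1) ->
        (forall t x, 1 <= t -> vnorm X (B t x) <= c / Rpower t (1 + eps) * vnorm X x) ->
        evolution_family U ->
        (forall t tau x, 1 <= tau -> tau <= t ->
           is_RInt (fun s => T t s (B s (U s tau x))) tau t
                   (vsub (U t tau x) (T t tau x))) ->
        exists eps', 0 <= eps' /\ strong_npd U eps'.
Proof.
intros X T eps Heps HT [[P [lam [D [Hlam [HD [HP [Hcomm [Hinv [Hs Hu]]]]]]]]] [K [b [HK [Hb Hg]]]]].
(* Enlarging the growth exponent to [Rmax b lam] secures the condition [lam <= b] of the Lyapunov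
   norm. *)
assert (Hg' : forall t tau x, 1 <= tau -> tau <= t ->
  vnorm X (T t tau x) <= K * Rpower (t / tau) (Rmax b lam) * Rpower tau eps * vnorm X x).
{ intros t tau x Htau Ht. eapply Rle_trans; [now apply Hg|].
  apply Rmult_le_compat_r; [apply vnorm_nonneg|].
  apply Rmult_le_compat_r; [apply Rlt_le, Rpower_pos|].
  apply Rmult_le_compat_l; [lra|].
  apply Rle_Rpower; [apply ratio_ge1; lra | apply Rmax_l]. }
destruct (lyapunov_norm_exists HD HK Hs Hu Hg') as [N HN].
assert (HA : adapted_norm T P N lam (Rmax b lam) (D + K) eps).
{ apply lyapunov_adapted; try easy.
  - apply Rmax_r.
  - intros t tau Htau Ht. now apply Hinv.
  - intros t tau y Htau Ht. now apply Hinv. }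
set (h := Rpower 16 (/ lam)).
set (H := Rpower h (Rmax b lam)).
(* [m] is the factor of [c] in the smallness condition of [strong_npd_perturbed], with [C = D + K];
   the threshold [/ (32 * m)] is that condition solved for [c]. *)
set (m := 2 * H * (D + K) * h * (4 * H)).
assert (Hm : 0 < m).
{ assert (0 < H) by apply Rpower_pos. assert (0 < h) by apply Rpower_pos.
  unfold m. repeat apply Rmult_lt_0_compat; lra. }
exists (/ (32 * m)). split; [apply Rinv_0_lt_compat; lra|].
intros c B U Hc Hc0 _ _ HB HU Hint. exists eps. split; [easy|].
apply (strong_npd_perturbed HT HA Hc HB HU Hint). fold h H m.
apply Rmult_le_compat_r with (r := m) in Hc0; [|lra].
replace (/ (32 * m) * m) with (1 / 32) in Hc0 by (field; lra). exact Hc0.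
Qed.
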